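(* Let $G$ be an irreducible ($\rho$-uniform) stochastic graph and let $\phi\in\mathcal{H}om(G,I)$. Then (i) $\zeta_G\vee\delta_\phi^{(\infty)}=\varepsilon_{X_G}$; (ii) $d(T_G)\le d(T_G,\delta_\phi)=d(\phi)<\infty$.
   Context: **Stochastic graphs and Markov shifts.** A stochastic graph $(G,p)$ is a directed graph with countable (finite or infinite) edge set $G$, vertex set $G^{(0)}$, start and terminal maps $s,t:G\to G^{(0)}$, such that $G_u=\{g:s(g)=u\}$ and ${}_vG=\{g:t(g)=v\}$ are nonempty for all vertices, with weights $p(g)>0$ satisfying $\sum_{g\in G_u}p(g)=1$ for every $u$. Standing assumption (positive recurrence): there are stationary probabilities $p^{(0)}(u)>0$ with $\sum_u p^{(0)}(u)=1$ and $\sum_{g\in {}_vG}p(g)p^{(0)}(s(g))=p^{(0)}(v)$ for all $v$. $G$ is irreducible if for all vertices $u,v$ there are $g_1,\dots,g_n\in G$ with $s(g_k)=t(g_{k+1})$, $s(g_n)=u$, $t(g_1)=v$. Let $X_G=\{(x_n)_{n\ge1}\in G^{\mathbb N}: s(x_n)=t(x_{n+1})\ \forall n\}$, with $m_G(x_1=g_1,\dots,x_n=g_n)=p(g_1)\cdots p(g_n)p^{(0)}(s(g_n))$ on cylinders. The one-sided Markov shift $T_G(x_n)=(x_{n+1})$ preserves $m_G$ and is ergodic iff $G$ is irreducible. $\zeta_G=\{A(g)\}_{g\in G}$, $A(g)=\{x\in X_G:x_1=g\}$, is the standard Markov generator. **Homomorphisms.** A homomorphism $\phi:G\to H$ is a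 map of edges for which there is $\phi^{(0)}:G^{(0)}\to H^{(0)}$ with $s(\phi(g))=\phi^{(0)}(s(g))$, $t(\phi(g))=\phi^{(0)}(t(g))$, $\phi^{(0)}$ surjective, $\phi|_{G_u}:G_u\to H_{\phi^{(0)}(u)}$ bijective for every $u$, and $p(\phi(g))=p(g)$; $\mathcal{H}om(G,H)$ is the set of homomorphisms. The factor map is $\Phi_\phi:X_G\to X_H$, $(x_n)\mapsto(\phi(x_n))$. The degree $d(\phi)$ is the number $d$ such that for a.e. $x\in X_H$ the fibre $\Phi_\phi^{-1}(x)$ consists of $d$ points (mod null sets: the conditional measures of $m_G$ on fibres are uniform on $d$ points). **Bernoulli graph.** $I$ finite or countable, $\rho(i)>0$, $\sum_{i\in I}\rho(i)=1$; $(I,\rho)$ is the stochastic graph with edge set $I$, weights $\rho(i)$ and a single vertex. $G$ is $\rho$-uniform if $\mathcal{H}om(G,I)\ne\emptyset$. **Indices.** $\varepsilon_X$ is the partition of $X$ into points; all partitions are mod 0. For an endomorphism $T$ of $(X,m)$, $\Delta_\rho(T)$ is the set of partitions $\delta=\{B(i)\}_{i\in I}$ with $m(B(i))=\rho(i)$, independent of $T^{-1}\varepsilon=\{T^{-1}x\}$ and with $\delta\vee T^{-1}\varepsilon=\varepsilon$. Put $\delta^{(\infty)}=\bigvee_{n\ge1}T^{-n+1}\delta$. For ergodic $T$ and $\delta\in\Delta_\rho(T)$ there is $d(T,\delta)\in\mathbb N\cup\{\infty\}$ such that the conditional measure of $\{x\}$ in its element of $\delta^{(\infty)}$ is $1/d(T,\delta)$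 for a.e. $x$; the minimal index is $d(T)=\min_{\delta\in\Delta_\rho(T)}d(T,\delta)$. For $\phi\in\mathcal{H}om(G,I)$ let $\delta_\phi=\{B(i)\}_{i\in I}$, $B(i)=\{x\in X_G:\phi(x_1)=i\}$; one has $\delta_\phi\in\Delta_\rho(T_G)$. *)

(* Defs.v *)
From HB Require Import structures.
From mathcomp Require Import all_boot all_order all_algebra.
From mathcomp Require Import all_classical all_reals all_analysis.

Set Implicit Arguments.
Unset Strict Implicit.
Unset Printing Implicit Defensive.

Import Order.TTheory GRing.Theory Num.Theory.

Local Open Scope classical_set_scope.
Local Open Scope ring_scope.
Local Open Scope ereal_scope.

(* The field [stat] is the stationary probability vector p^(0): positive
   recurrence is part of the structure, as a standing assumption.  It is data
   because it enters the definition of the Markov measure; it is unique when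
   the graph is irreducible. *)
Record stoch_graph (R : realType) := StochGraph {
  edge : countType;
  vertex : countType;
  src : edge -> vertex;
  tgt : edge -> vertex;
  wt : edge -> R;
  stat : vertex -> R;
  out_nonempty : forall u, exists g, src g = u;
  in_nonempty : forall v, exists g, tgt g = v;
  wt_gt0 : forall g, (0 < wt g)%R;
  wt_sum : forall u, \esum_(g in [set g | src g = u]) (wt g)%:E = 1;
  stat_gt0 : forall u, (0 < stat u)%R;
  stat_sum : \esum_(u in [set: vertex]) (stat u)%:E = 1;
  stat_inv : forall v,
    \esum_(g in [set g | tgt g = v]) (wt g * stat (src g))%:E = (stat v)%:E }.

Arguments edge {R} _.
Arguments vertex {R} _.

(* A path from u to v is g 0, ..., g n, traversed from g n down to g 0. *)
Definition irreducible (R : realType) (G : stoch_graph R) :=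
  forall u v : vertex G, exists (n : nat) (g : nat -> edge G),
    [/\ forall k, (k < n)%N -> src (g k) = tgt (g k.+1),
        src (g n) = u & tgt (g 0%N) = v].

(* Sequences are indexed from 0: [path x n] is the coordinate x_(n+1). *)
Record path_space (R : realType) (G : stoch_graph R) := PathSpace {
  path :> nat -> edge G;
  pathP : forall n, src (path n) = tgt (path n.+1) }.

Lemma path_space_inhabited (R : realType) (G : stoch_graph R) :
  exists x : path_space G, True.
Proof.
have [u _] : exists u : vertex G, True.
  apply: contrapT => noV; have := stat_sum G.
  rewrite (_ : [set: _] = set0) ?esum_set0.
    by move/eqP; rewrite eq_sym onee_eq0.
  by apply/seteqP; split => // u _; apply: noV; exists u.
pose pre v := projT1 (cid (in_nonempty (s := G) v)).
have preP v : tgt (pre v) = v by rewrite /pre; case: cid.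
pose x n := iter n (fun g => pre (src g)) (pre u).
by exists (@PathSpace _ G x (fun n => esym (preP (src (x n))))).
Qed.

HB.instance Definition _ (R : realType) (G : stoch_graph R) :=
  gen_eqMixin (path_space G).
HB.instance Definition _ (R : realType) (G : stoch_graph R) :=
  gen_choiceMixin (path_space G).
HB.instance Definition _ (R : realType) (G : stoch_graph R) :=
  isPointed.Build (path_space G) (projT1 (cid (path_space_inhabited G))).

Definition coordinate_sets (R : realType) (G : stoch_graph R) :
    set (set (path_space G)) :=
  [set A | exists (n : nat) (g : edge G), A = [set x | path x n = g]].

HB.instance Definition _ (R : realType) (G : stoch_graph R) :=
  @isMeasurable.Build (sigma_display (@coordinate_sets R G)) (path_space G)
    <<s @coordinate_sets R G >>
    (@sigma_algebra0 _ setT (@coordinate_sets R G))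
    (@sigma_algebraC _ (@coordinate_sets R G))
    (@sigma_algebra_bigcup _ setT (@coordinate_sets R G)).

(* The cylinders form a pi-system, so this determines the measure m_G. *)
Definition markov_measure (R : realType) (G : stoch_graph R)
    (m : probability (path_space G) R) :=
  forall (n : nat) (g : nat -> edge G),
    (forall k, (k < n)%N -> src (g k) = tgt (g k.+1)) ->
    m [set x | forall k, (k <= n)%N -> path x k = g k] =
      ((\prod_(k < n.+1) wt (g k)) * stat (src (g n)))%:E.

Definition markov_shift (R : realType) (G : stoch_graph R)
    (x : path_space G) : path_space G :=
  @PathSpace R G (fun n => path x n.+1) (fun n => pathP x n.+1).

Record graph_hom (R : realType) (G H : stoch_graph R) := GraphHom {
  hom_edge :> edge G -> edge H;
  hom_edgeP : exists hom_vertex : vertex G -> vertex H,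
    [/\ forall g, src (hom_edge g) = hom_vertex (src g),
        forall g, tgt (hom_edge g) = hom_vertex (tgt g),
        forall v, exists u, hom_vertex u = v,
        forall u, set_bij [set g | src g = u]
                          [set h | src h = hom_vertex u] hom_edge &
        forall g, wt (hom_edge g) = wt g] }.

Lemma hom_path (R : realType) (G H : stoch_graph R) (phi : graph_hom G H)
  (x : path_space G) (n : nat) :
  src (phi (path x n)) = tgt (phi (path x n.+1)).
Proof. by have [f [sE tE _ _ _]] := hom_edgeP phi; rewrite sE tE pathP. Qed.

Definition factor_map (R : realType) (G H : stoch_graph R)
    (phi : graph_hom G H) (x : path_space G) : path_space H :=
  @PathSpace R H (fun n => phi (path x n)) (hom_path phi x).

Section bernoulli.
Variables (R : realType) (I : countType) (rho : I -> R).
Hypothesis rho_gt0 : forall i, (0 < rho i)%R.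
Hypothesis rho_sum : \esum_(i in [set: I]) (rho i)%:E = 1.

Let bernoulli_nonempty (u : unit) : exists i : I, tt = u.
Proof.
case: u; have [i _] : exists i : I, True; last by exists i.
apply: contrapT => noI; have := rho_sum.
rewrite (_ : [set: _] = set0) ?esum_set0.
  by move/eqP; rewrite eq_sym onee_eq0.
by apply/seteqP; split => // i _; apply: noI; exists i.
Qed.

Let bernoulli_wt (u : unit) : \esum_(i in [set i : I | tt = u]) (rho i)%:E = 1.
Proof.
rewrite -[RHS]rho_sum; congr esum.
by case: u; apply/seteqP; split.
Qed.

Let bernoulli_stat_gt0 (u : unit) : (0 < (1 : R))%R.
Proof. exact: ltr01. Qed.

Let bernoulli_stat_sum : \esum_(u in [set: unit]) ((1 : R)%:E) = 1.
Proof.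
rewrite (_ : [set: unit] = [set tt]) ?esum_set1 ?lee01//.
by apply/seteqP; split=> // -[].
Qed.

Let bernoulli_stat_inv (u : unit) :
  \esum_(i in [set i : I | tt = u]) (rho i * 1)%:E = (1 : R)%:E.
Proof.
by rewrite -[RHS](bernoulli_wt u); apply: eq_esum => i _; rewrite mulr1.
Qed.

Definition bernoulli_graph : stoch_graph R :=
  @StochGraph R I unit (fun=> tt) (fun=> tt) rho (fun=> 1%R)
    bernoulli_nonempty bernoulli_nonempty rho_gt0 bernoulli_wt
    bernoulli_stat_gt0 bernoulli_stat_sum bernoulli_stat_inv.

End bernoulli.

(* A partition of X is represented by the relation "x and y lie in the same
   element"; the point partition [epsilon] is then equality. *)
Definition epsilon (X : Type) : X -> X -> Prop := fun x y => x = y.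

(* The partition { beta = i }_i. *)
Definition level_part (X I : Type) (beta : X -> I) : X -> X -> Prop :=
  fun x y => beta x = beta y.

Definition part_preimage (X Y : Type) (T : X -> Y) (xi : Y -> Y -> Prop) :
    X -> X -> Prop :=
  fun x y => xi (T x) (T y).

Definition part_join (X : Type) (xi eta : X -> X -> Prop) : X -> X -> Prop :=
  fun x y => xi x y /\ eta x y.

Definition part_bigjoin (X : Type) (xi : nat -> X -> X -> Prop) :
    X -> X -> Prop :=
  fun x y => forall n, xi n x y.

Definition part_eq_mod0 d (X : measurableType d) (R : realType)
    (m : probability X R) (xi eta : X -> X -> Prop) :=
  exists N : set X, m.-negligible N /\
    forall x y, ~ N x -> ~ N y -> (xi x y <-> eta x y).

(* Rokhlin's canonical system of conditional measures: [kappa x] is the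
   conditional measure on the element of xi containing x. *)
Definition conditional_measures d (X : measurableType d) (R : realType)
    (m : probability X R) (xi : X -> X -> Prop) (kappa : R.-pker X ~> X) :=
  [/\ forall x y, xi x y -> forall A, kappa x A = kappa y A,
      {ae m, forall x, {ae kappa x, forall y, xi x y}} &
      forall A, measurable A -> m A = \int[m]_x kappa x A].

(* The conditional measures of m on the fibres of f : X -> Y, where m' is the
   image of m (this is forced by the last clause). *)
Definition fibre_measures d d' (X : measurableType d) (Y : measurableType d')
    (R : realType) (m : probability X R) (m' : probability Y R) (f : X -> Y)
    (kappa : R.-pker Y ~> X) :=
  {ae m', forall y, {ae kappa y, forall x, f x = y}} /\
  forall A, measurable A -> m A = \int[m']_y kappa y A.

(* delta = { beta = i }_i belongs to Delta_rho(T).  Every partition mod 0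
   indexed by I is of this form, I being nonempty.  Independence of T^-1 epsilon
   is independence of its sigma-algebra, which consists of the T^-1 A. *)
Definition Delta d (X : measurableType d) (R : realType)
    (m : probability X R) (T : X -> X) (I : countType) (rho : I -> R)
    (beta : X -> I) :=
  [/\ forall i, measurable (beta @^-1` [set i]),
      forall i, m (beta @^-1` [set i]) = (rho i)%:E,
      forall i A, measurable A ->
        m (beta @^-1` [set i] `&` T @^-1` A) =
        m (beta @^-1` [set i]) * m (T @^-1` A) &
      part_eq_mod0 m
        (part_join (level_part beta) (part_preimage T (@epsilon X)))
        (@epsilon X)].

(* delta^(oo), the join of the T^-n delta for n >= 0. *)
Definition delta_infty (X I : Type) (T : X -> X) (beta : X -> I) :
    X -> X -> Prop :=
  part_bigjoin (fun n => part_preimage (iter n T) (level_part beta)).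

(* d(T, delta) = k, with k a positive integer or +oo; recall that (+oo)^-1 = 0
   in the extended reals. *)
Definition is_index d (X : measurableType d) (R : realType)
    (m : probability X R) (T : X -> X) (I : Type) (beta : X -> I)
    (k : \bar R) :=
  ((exists n : nat, k = n.+1%:R%:E) \/ k = +oo) /\
  exists kappa : R.-pker X ~> X,
    conditional_measures m (delta_infty T beta) kappa /\
    {ae m, forall x, kappa x [set x] = k^-1}.

(* d(T) = k *)
Definition is_minimal_index d (X : measurableType d) (R : realType)
    (m : probability X R) (T : X -> X) (I : countType) (rho : I -> R)
    (k : \bar R) :=
  (exists2 beta : X -> I, Delta m T rho beta & is_index m T beta k) /\
  forall (beta : X -> I) (l : \bar R),
    Delta m T rho beta -> is_index m T beta l -> k <= l.

(* d(phi) = k: after removal of a null set N, almost every fibre consists of k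
   points, on which the conditional measure is uniform. *)
Definition is_degree (R : realType) (G H : stoch_graph R)
    (mG : probability (path_space G) R) (mH : probability (path_space H) R)
    (phi : graph_hom G H) (k : \bar R) :=
  exists (kappa : R.-pker (path_space H) ~> (path_space G))
         (N : set (path_space G)),
    [/\ fibre_measures mG mH (factor_map phi) kappa,
        mG.-negligible N &
        {ae mH, forall y,
          let F := factor_map phi @^-1` [set y] `\` N in
          counting F = k /\ forall x, F x -> kappa y [set x] = k^-1}].

Definition zeta (R : realType) (G : stoch_graph R) :
    path_space G -> path_space G -> Prop :=
  level_part (fun x : path_space G => path x 0%N).

(* The labelling function of delta_phi. *)
Definition hom_label (R : realType) (G H : stoch_graph R)
    (phi : graph_hom G H) (x : path_space G) : edge H := phi (path x 0%N).

(* Main.v *)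
(** Every label i acts on vertices by the map sending u to the target of the
    edge of G_u labelled i, so a path over a label sequence y is a sequence of
    vertices compatible with these maps.  Let q_v(y) be the conditional
    probability, given the labels y of x, that x_1 ends at v.  Prepending an
    edge to x can only increase the conditional probability of its own endpoint
    (the maps may merge vertices), hence by ergodicity of T_G this probability
    is a.e. a constant c.  So q_v(y) is 0 or c, and as the q_v(y) sum to 1 we
    get c = 1/d, where exactly d vertices are charged by y.  The map attached to
    a label carries the charged vertices of the shifted sequence bijectively
    onto those of y: the fibre over y consists of d paths, told apart by their
    first endpoint, with the uniform conditional measure.

    Ergodicity is elementary: if B is an invariant set, the measures of B in
    [x_1 ends at v] form a stationary vector, which is proportional to p^(0) by
    irreducibility, so that m_G restricted to B is a multiple of m_G. *)

Require Import Defs.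
From HB Require Import structures.
From mathcomp Require Import finmap all_boot all_order all_algebra.
From mathcomp Require Import all_classical all_reals all_analysis.
From mathcomp Require Import measurable_realfun.

Set Implicit Arguments.
Unset Strict Implicit.
Unset Printing Implicit Defensive.

Import Order.TTheory GRing.Theory Num.Theory.

Local Open Scope classical_set_scope.
Local Open Scope ring_scope.
Local Open Scope ereal_scope.

(** * Countable sums and almost everywhere statements *)

Lemma measurable_preimage d (S : measurableType d) d' (S' : measurableType d')
    (f : S -> S') (A : set S') :
  measurable_fun setT f -> measurable A -> measurable (f @^-1` A).
Proof. by move=> mf mA; rewrite -[X in measurable X]setTI; exact: mf. Qed.

(** Enumerating [V] by its codes turns the sum into a series, to which countable additivity and
    monotone convergence apply; integers that code nothing contribute 0. *)
Lemma esum_pickle (R : realType) (V : countType) (a : V -> \bar R) :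
  (forall v, 0 <= a v) ->
  \esum_(v in [set: V]) a v = \sum_(n <oo) oapp a 0 (pickle_inv n).
Proof.
move=> a0; have b0 n : 0 <= oapp a 0 (@pickle_inv V n) by case: pickle_inv.
rewrite nneseries_esumT//.
transitivity (\esum_(n in range (@pickle V)) oapp a 0 (pickle_inv n)).
  rewrite esum_image; last by move=> u v _ _ /(pcan_inj (@pickleK V)).
  by apply: eq_esum => v _; rewrite pickleK_inv.
rewrite esum_mkcond; apply: eq_esum => n _; case: ifPn => // /negP nV.
case E: (pickle_inv n) => [v|//]; exfalso; apply: nV; rewrite inE; exists v => //.
by have := @pickle_invK V n; rewrite /ocancel E.
Qed.

Section countable_sums.
Context d (T : measurableType d) (R : realType) (V : countType).
Implicit Types (mu : {measure set T -> \bar R}) (f : V -> T -> \bar R).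

Lemma emeasurable_esum (D : set T) f :
  (forall v, measurable_fun D (f v)) -> (forall v x, 0 <= f v x) ->
  measurable_fun D (fun x => \esum_(v in [set: V]) f v x).
Proof.
move=> mf f0.
rewrite (_ : (fun x => _) =
  fun x => \sum_(n <oo) oapp (f^~ x) 0 (pickle_inv n)); last first.
  by apply/funext => x; rewrite esum_pickle.
apply: (ge0_emeasurable_sum (h := fun n x => oapp (f^~ x) 0 (pickle_inv n))
  (P := xpredT)) => [n x _ _|n _]; first by case: pickle_inv => /=.
by case: pickle_inv => [v|] //=; exact: mf.
Qed.

Lemma integral_esum mu (D : set T) f : measurable D ->
  (forall v, measurable_fun D (f v)) -> (forall v x, 0 <= f v x) ->
  \int[mu]_(x in D) (\esum_(v in [set: V]) f v x) =
  \esum_(v in [set: V]) \int[mu]_(x in D) f v x.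
Proof.
move=> mD mf f0.
rewrite esum_pickle => [|v]; last by apply: integral_ge0.
under eq_integral do rewrite esum_pickle//.
rewrite (integral_nneseries mu mD (f := fun n x => oapp (f^~ x) 0 (pickle_inv n))).
- apply: eq_eseriesr => n _; case: pickle_inv => //=.
  by rewrite integral0.
- by move=> n; case: pickle_inv => [v|] //=; exact: mf.
- by move=> n x _ /=; case: pickle_inv => [v|] /=.
Qed.

Lemma measure_esum mu (f : T -> V) (A : set T) : measurable A ->
  (forall v, measurable (f @^-1` [set v])) ->
  mu A = \esum_(v in [set: V]) mu (A `&` f @^-1` [set v]).
Proof.
move=> mA mf; rewrite esum_pickle//.
pose F n := A `&` oapp (fun v => f @^-1` [set v]) set0 (pickle_inv n).
have FE : \bigcup_n F n = A.
  rewrite -setI_bigcupr setIidl// => x _; exists (pickle (f x)) => //=.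
  by rewrite pickleK_inv.
rewrite -[in LHS]FE measure_semi_bigcup.
- apply: eq_eseriesr => n _; rewrite /F; case: pickle_inv => //=.
  by rewrite setI0 measure0.
- move=> n; rewrite /F; case: pickle_inv => [v|] /=; first exact: measurableI.
  by rewrite setI0.
- move=> m n _ _ [x []]; rewrite /F.
  case Em: (pickle_inv m) => [u|] /=; last by case.
  case En: (pickle_inv n) => [v|] /=; last by move=> _ [].
  move=> [_ fu] [_ fv].
  have := @pickle_invK V m; have := @pickle_invK V n.
  by rewrite /ocancel Em En /= -fv -fu => <- <-.
- rewrite FE//.
Qed.

Lemma measurable_bigcup_count (D : set V) (F : V -> set T) :
  (forall v, measurable (F v)) -> measurable (\bigcup_(v in D) F v).
Proof.
move=> mF; rewrite bigcup_mkcond.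
by apply: countable_bigcupT_measurable => // v; case: ifP.
Qed.

Lemma ae_forall_count mu (P : V -> T -> Prop) :
  (forall v, \forall x \ae mu, P v x) -> \forall x \ae mu, forall v, P v x.
Proof.
move=> aeP.
have /ae_foralln : forall n, \forall x \ae mu, oapp (P^~ x) True (pickle_inv n).
  by move=> n; case: pickle_inv => [v|] /=; [exact: aeP|exact: aeW].
by apply: filterS => x Px v; have := Px (pickle v); rewrite pickleK_inv.
Qed.

End countable_sums.

(** Finite totals allow the sum over the other indices to be cancelled, so no single term can be
    strictly larger. *)
Lemma le_esum_eq (R : realType) (V : choiceType) (a b : V -> \bar R) :
  (forall v, 0 <= a v) -> (forall v, a v <= b v) ->
  \esum_(v in [set: V]) b v <= \esum_(v in [set: V]) a v ->
  \esum_(v in [set: V]) a v < +oo ->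
  forall v, a v = b v.
Proof.
move=> a0 ab sba saoo v; apply/eqP; rewrite eq_le ab/=.
have b0 u : 0 <= b u by exact: le_trans (ab u).
have split (c : V -> \bar R) : (forall v, 0 <= c v) -> \esum_(u in [set: V]) c u =
    c v + \esum_(u in ~` [set v]) c u.
  by move=> c0; rewrite (esumID [set v])// !setTI esum_set1.
have rfin : \esum_(u in ~` [set v]) a u \is a fin_num.
  rewrite ge0_fin_numE ?esum_ge0//; apply: le_lt_trans saoo.
  by rewrite (split a)// leeDr.
have : b v + \esum_(u in ~` [set v]) a u <= a v + \esum_(u in ~` [set v]) a u.
  rewrite -(split a)//; apply: le_trans sba; rewrite (split b)//.
  by apply: leeD => //; apply: le_esum.
by rewrite leeD2rE.
Qed.

Lemma esum_fibre (R : realType) (U : choiceType) (V : choiceType) (f : U -> V)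
    (a : U -> \bar R) : (forall u, 0 <= a u) ->
  \esum_(v in [set: V]) \esum_(u in [set u | f u = v]) a u =
  \esum_(u in [set: U]) a u.
Proof.
move=> a0; rewrite esum_esum//; apply/esym/(reindex_esum _ _ snd); split => //.
- by move=> [v u] [w z]; rewrite !inE /= => -[_ <-] [_ <-] ->.
- by move=> u _; exists (f u, u).
Qed.

Lemma esumZl (R : realType) (V : countType) (D : set V) (c : R)
    (a : V -> \bar R) : (0 <= c)%R -> (forall v, 0 <= a v) ->
  \esum_(v in D) (c%:E * a v) = c%:E * \esum_(v in D) a v.
Proof.
move=> c0 a0; rewrite esum_mkcond [in RHS]esum_mkcond !esum_pickle; last 2 first.
- by move=> v; case: ifP.
- by move=> v; case: ifP => // _; rewrite mule_ge0.
rewrite -nneseriesZl; last by move=> n _; case: pickle_inv => //= v; case: ifP.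
apply: eq_eseriesr => n _; case: pickle_inv => [v|] /=; last by rewrite mule0.
by case: ifP; rewrite ?mule0.
Qed.

Lemma esum_cst_infinite (R : realType) (V : choiceType) (A : set V) (c : R) :
  (0 < c)%R -> infinite_set A -> \esum_(v in A) c%:E = +oo.
Proof.
move=> c0 infA; apply/eqyP => r r0.
have [F FA rF] := infinite_set_fset (Num.bound (r / c)) infA.
apply: esum_ge; exists [set` F]; first by split.
rewrite fsbig_finite//= set_fsetK sumEFin big_const_seq iter_addr addr0.
rewrite count_predT lee_fin -mulr_natl -ler_pdivrMr//.
by rewrite (le_trans (ltW (archi_boundP (ltW (divr_gt0 r0 c0)))))// ler_nat.
Qed.

(** Some value is nonzero, so [c] is positive; then only finitely many values equal [c], and their
    number times [c] is 1. *)
Lemma esum_two_values (R : realType) (V : choiceType) (a : V -> R) (c : R) :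
  (forall v, (0 <= a v)%R) -> (forall v, a v = 0%R \/ a v = c) ->
  \esum_(v in [set: V]) (a v)%:E = 1 ->
  exists n, c = n.+1%:R^-1%R /\ ([set v | a v = c] #= `I_n.+1)%card.
Proof.
move=> a0 ac sa.
have [v av0] : exists v, a v <> 0%R.
  apply: contrapT => H; move: sa; rewrite esum1; last first.
    by move=> v _; congr EFin; apply: contrapT => av; apply: H; exists v.
  by move/eqP; rewrite eq_sym onee_eq0.
have avc : a v = c by have [/av0|] := ac v.
have c0 : (0 < c)%R by rewrite -avc lt_neqAle a0 andbT eq_sym; apply/eqP.
pose A := [set v | a v = c].
have {}sa : \esum_(v in A) c%:E = 1.
  rewrite -sa esum_mkcond; apply: eq_esum => u _; case: ifPn.
    by rewrite inE => ->.
  by rewrite notin_setE => nu; have [->//|/nu] := ac u.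
have finA : finite_set A.
  by apply: contrapT => /(esum_cst_infinite c0); rewrite sa.
have /finite_setP[[|n] An] := finA.
  by move: An; rewrite II0 card_eq0 => /eqP A0; have : A v by []; rewrite A0.
exists n; split => //.
move: sa; rewrite esum_fset//; last by move=> u _; rewrite lee_fin ltW.
rewrite fsbig_finite//= sumEFin big_const_seq iter_addr addr0 count_predT.
rewrite (card_fset_set An) => -[] cn.
apply: (mulIf (x := n.+1%:R)); first by rewrite pnatr_eq0.
by rewrite mulVf ?pnatr_eq0// mulr_natr.
Qed.

Lemma ge0_integral_ae_eq d (T : measurableType d) (R : realType)
    (mu : {measure set T -> \bar R}) (f g : T -> \bar R) :
  measurable_fun setT f -> measurable_fun setT g -> (forall x, 0 <= f x) ->
  \int[mu]_x f x < +oo ->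
  (forall E, measurable E -> \int[mu]_(x in E) f x = \int[mu]_(x in E) g x) ->
  \forall x \ae mu, f x = g x.
Proof.
move=> mf mg f0 foo fg.
have : ae_eq mu setT f g.
  apply: integral_ae_eq => //; last by move=> E _; exact: fg.
  apply/integrableP; split => //.
  by under eq_integral do rewrite gee0_abs//.
by apply: filterS => x; exact.
Qed.

(** Rational thresholds suffice: off one null set every [f x] lies on the same side of each rational
    as a fixed [f x0], and distinct reals are separated by a rational. *)
Lemma ae_bool_cst d (T : measurableType d) (R : realType)
    (P : probability T R) (f : T -> R) :
  (forall r : R, (\forall x \ae P, (r < f x)%R) \/ (\forall x \ae P, (f x <= r)%R)) ->
  exists c, \forall x \ae P, f x = c.
Proof.
move=> fP.
have fb (r : rat) : exists b : bool, \forall x \ae P, (ratr r < f x)%R = b.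
  have [H|H] := fP (ratr r); [exists true|exists false] => //.
  by apply: filterS H => x; rewrite ltNge => ->.
have [b bP] := choice fb.
have {bP} aeb := ae_forall_count bP.
have [x0 x0b] : exists x, forall r : rat, (ratr r < f x)%R = b r.
  apply: contrapT => nob; have : P.-negligible setT.
    by apply: negligibleS aeb => x _ /= xb; apply: nob; exists x.
  move=> /(measure_negligible measurableT) /eqP.
  by rewrite [X in X == _]probability_setT onee_eq0.
exists (f x0); apply: filterS aeb => x xb; apply/eqP; rewrite eq_le !leNgt.
apply/andP; split; apply/negP => /rat_in_itvoo [r]; rewrite in_itv /= => /andP[h1 h2].
  by have := xb r; rewrite h2 -x0b ltNge (ltW h1).
by have := x0b r; rewrite h2 -xb ltNge (ltW h1).
Qed.

Lemma radon_nikodym_real d (T : measurableType d) (R : realType)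
    (mu : probability T R) (nu : {measure set T -> \bar R}) :
  nu setT < +oo -> (forall A, measurable A -> mu A = 0 -> nu A = 0) ->
  exists q : T -> R, [/\ forall y, (0 <= q y)%R, measurable_fun setT q &
    forall A, measurable A -> nu A = \int[mu]_(y in A) (q y)%:E].
Proof.
move=> nuoo nu_mu.
pose nu' : {finite_measure set T -> \bar R} := mfrestr measurableT nuoo.
have nuE A : nu' A = nu A by rewrite /nu' /= /mfrestr /mrestr setIT.
have nu_dom : nu' `<< mu by apply/null_content_dominatesP => A mA A0; rewrite nuE nu_mu.
have [f [f0 ffin fint fE]] := radon_nikodym_sigma_finite nu_dom.
exists (fine \o f); split.
- by move=> y; exact: fine_ge0.
- by apply: measurableT_comp => //; exact: (measurable_int mu fint).
- move=> A mA; rewrite -nuE fE//.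
  by apply: eq_integral => y _; rewrite /= fineK.
Qed.

Lemma ae_preimage d d' (T : measurableType d) (T' : measurableType d')
    (R : realType) (m : {measure set T -> \bar R})
    (m' : {measure set T' -> \bar R}) (f : T -> T') (P : T' -> Prop) :
  measurable_fun setT f ->
  (forall A, measurable A -> m (f @^-1` A) = m' A) ->
  (\forall y \ae m', P y) -> \forall x \ae m, P (f x).
Proof.
move=> mf mm' [A [mA A0 PA]]; exists (f @^-1` A); split.
- by rewrite -[X in measurable X]setTI; exact: mf.
- by rewrite mm'.
- by move=> x Px; exact: PA.
Qed.

Lemma ae_iter d (T : measurableType d) (R : realType)
    (m : {measure set T -> \bar R}) (f : T -> T) (P : T -> Prop) :
  measurable_fun setT f ->
  (forall A, measurable A -> m (f @^-1` A) = m A) ->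
  (\forall x \ae m, P x) -> \forall x \ae m, forall k, P (iter k f x).
Proof.
move=> mf mm aeP; apply: ae_foralln => k; elim: k => [//|k IH].
by apply: filterS (ae_preimage mf mm IH) => x; rewrite iterSr.
Qed.

Lemma measure_ae_eq d (T : measurableType d) (R : realType)
    (m : {measure set T -> \bar R}) (A B : set T) :
  measurable A -> measurable B ->
  (\forall x \ae m, A x <-> B x) -> m A = m B.
Proof.
move=> mA mB AB.
have null C D : measurable C -> measurable D ->
    (\forall x \ae m, C x <-> D x) -> m (C `\` D) = 0.
  move=> mC mD CD; apply: measure_negligible; first exact: measurableD.
  by apply: negligibleS CD => x [Cx Dx] [/(_ Cx)].
rewrite [LHS](measureDI m mA mB) [RHS](measureDI m mB mA) setIC.
congr (_ + _); rewrite [LHS]null// [RHS]null//.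
by apply: filterS AB => x [].
Qed.

Section reindexed_kernel.
Context d d' d'' (X : measurableType d) (Y : measurableType d')
  (Z : measurableType d'') (R : realType).
Context (k : R.-pker Y ~> Z) (f : X -> Y).

(** Reindexes fibre measures by the points of [X], the form asked for by [conditional_measures]. The
    proof [mf] is an argument so that the kernel instances can be attached. *)
Definition kernel_comp (mf : measurable_fun setT f) (x : X) :
  {measure set Z -> \bar R} := k (f x).

Hypothesis mf : measurable_fun setT f.

Let measurable_kernel_comp U : measurable U ->
  measurable_fun setT (kernel_comp mf ^~ U).
Proof. by move=> mU; exact: measurableT_comp (measurable_kernel k U mU) mf. Qed.

HB.instance Definition _ :=
  isKernel.Build _ _ X Z R (kernel_comp mf) measurable_kernel_comp.

Let kernel_comp_setT x : kernel_comp mf x setT = 1.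
Proof. exact: prob_kernel. Qed.

HB.instance Definition _ :=
  Kernel_isProbability.Build _ _ X Z R (kernel_comp mf) kernel_comp_setT.

End reindexed_kernel.

(** * Stationary vectors *)

Section stationary.
Context (R : realType) (G : stoch_graph R) (irrG : irreducible G).
Context (beta : vertex G -> R) (beta_ge0 : forall v, (0 <= beta v)%R).
Hypothesis beta_fin : \esum_(v in [set: vertex G]) (beta v)%:E < +oo.
Hypothesis beta_stat : forall v,
  \esum_(g in [set g | tgt g = v]) (wt g * beta (src g))%:E = (beta v)%:E.

(* The positive part of beta - c stat is subinvariant, hence invariant since
   the chain preserves mass, so its support is closed under moving along edges. *)
Lemma stationary_gt c : (0 <= c)%R -> (exists u, c * stat u < beta u)%R ->
  forall v, (c * stat v < beta v)%R.
Proof.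
move=> c0 [u cu] v.
pose del w := Num.max (beta w - c * stat w)%R 0%R.
have del0 w : (0 <= del w)%R by rewrite /del le_max lexx orbT.
have wt0 (g : edge G) : (0 <= wt g)%R by rewrite ltW// wt_gt0.
have stat0 w : (0 <= stat w :> R)%R by rewrite ltW// stat_gt0.
have ge0 (g : edge G) : 0 <= (wt g * del (src g))%:E by rewrite lee_fin mulr_ge0.
pose D w := \esum_(g in [set g | tgt g = w]) (wt g * del (src g))%:E.
have delD w : (del w)%:E <= D w.
  have : (beta w)%:E <= D w + (c * stat w)%:E.
    rewrite -beta_stat EFinM -(stat_inv w) -esumZl//; last first.
      by move=> g; rewrite lee_fin mulr_ge0.
    rewrite -esumD//; last by move=> g _; rewrite -EFinM lee_fin !mulr_ge0.
    apply: le_esum => g _; rewrite -EFinM -EFinD lee_fin mulrCA -mulrDr.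
    by rewrite ler_wpM2l// -lerBlDr /del le_max lexx.
  rewrite -leeBlDr// -EFinB => bD; rewrite /del maxEle; case: ifPn => // _.
  exact: esum_ge0.
have sumD : \esum_(w in [set: vertex G]) D w = \esum_(w in [set: vertex G]) (del w)%:E.
  rewrite /D esum_fibre// -(esum_fibre (@src _ G))//; apply: eq_esum => w _.
  transitivity (\esum_(g in [set g | src g = w]) ((del w)%:E * (wt g)%:E)).
    by apply: eq_esum => g /= <-; rewrite -EFinM mulrC.
  by rewrite esumZl// wt_sum mule1.
have delfin : \esum_(w in [set: vertex G]) (del w)%:E < +oo.
  apply: le_lt_trans beta_fin; apply: le_esum => w _.
  by rewrite lee_fin ge_max beta_ge0 andbT gerBl mulr_ge0.
have delE : forall w, (del w)%:E = D w.
  by apply: le_esum_eq => //; rewrite sumD.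
have step (g : edge G) : (0 < del (src g) -> 0 < del (tgt g))%R.
  move=> sg; rewrite -lte_fin delE.
  apply: (@lt_le_trans _ _ (wt g * del (src g))%:E).
    by rewrite lte_fin mulr_gt0// wt_gt0.
  rewrite /D (esumID [set g])//= (_ : _ `&` [set g] = [set g]); last first.
    by apply/setIidr => _ ->.
  by rewrite esum_set1// leeDl// esum_ge0.
have delP w : (0 < del w)%R = (c * stat w < beta w)%R.
  by rewrite /del lt_max ltxx orbF subr_gt0.
rewrite -delP; rewrite -delP in cu.
have [n [g [gP gn g0]]] := irrG u v.
(* [g n] starts at [u] and [g 0] ends at [v], so positivity travels through [g (n - k)] as [k]
   grows. *)
rewrite -g0; have : forall k, (k <= n)%N -> (0 < del (tgt (g (n - k)%N)))%R.
  elim=> [_|k IH kn]; first by apply: step; rewrite subn0 gn.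
  apply: step; rewrite gP; last by rewrite ltn_subrL (leq_trans _ kn).
  by rewrite -subSn// subSS; apply: IH; exact: ltnW.
by move=> /(_ n (leqnn n)); rewrite subnn.
Qed.

(** With [c = beta u / stat u] equality holds at [u], so by [stationary_gt] no vertex can exceed it;
    exchanging [u] and [v] gives the reverse bound. *)
Lemma stationary_unique : exists2 c, (0 <= c)%R & forall v, beta v = (c * stat v)%R.
Proof.
have le u v : (beta v <= beta u / stat u * stat v)%R.
  rewrite leNgt; apply/negP => lt.
  have c0 : (0 <= beta u / stat u)%R by rewrite divr_ge0// ltW// stat_gt0.
  have := stationary_gt c0 (ex_intro _ v lt) u.
  by rewrite divfK ?ltxx// gt_eqF// stat_gt0.
have [x _] := path_space_inhabited G; pose u := src (x 0%N).
exists (beta u / stat u)%R; first by rewrite divr_ge0// ltW// stat_gt0.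
move=> v; apply/eqP; rewrite eq_le le/=.
by rewrite mulrAC ler_pdivrMr ?stat_gt0// -ler_pdivlMr ?stat_gt0// mulrAC le.
Qed.

End stationary.

(** * Path spaces and cylinders *)

Section path_space_theory.
Context (R : realType) (G : stoch_graph R).
Local Notation X := (path_space G).

Lemma path_space_eq (x y : X) : (forall n, x n = y n) -> x = y.
Proof.
case: x y => [x xP] [y yP] /= /funext xy; case: y / xy in yP *.
by rewrite (Prop_irrelevance xP yP).
Qed.

Lemma measurable_coord (n : nat) (P : edge G -> Prop) :
  measurable [set x : X | P (x n)].
Proof.
rewrite (_ : mkset _ = \bigcup_(g in P) [set x : X | x n = g]).
  apply: measurable_bigcup_count => g.
  by apply: sub_sigma_algebra; exists n, g.
by apply/seteqP; split => [x Px|x [g /= Pg ->]] //; exists (x n).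
Qed.

Lemma measurable_fun_path d (T : measurableType d) (D : set T) (f : T -> X) :
  (forall n g, measurable (D `&` [set t | (f t) n = g])) ->
  measurable_fun D f.
Proof.
move=> mf; apply: (measurability (@coordinate_sets R G)) => //.
by move=> _ [_ [n [g ->]] <-]; exact: mf.
Qed.

Lemma measurable_path_set1 (x : X) : measurable [set x].
Proof.
rewrite (_ : [set x] = \bigcap_n [set y : X | y n = x n]).
  by apply: bigcapT_measurable => n; exact: (measurable_coord n (eq^~ _)).
apply/seteqP; split => [_ -> //|y xy].
by apply: path_space_eq => n; exact: xy.
Qed.

Definition cylinder (n : nat) (g : nat -> edge G) : set X :=
  [set x | forall k, (k <= n)%N -> x k = g k].

Definition admissible (n : nat) (g : nat -> edge G) :=
  forall k, (k < n)%N -> src (g k) = tgt (g k.+1).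

Lemma measurable_cylinder n g : measurable (cylinder n g).
Proof.
rewrite (_ : cylinder n g =
    \bigcap_k [set x : X | (k <= n)%N -> x k = g k]).
  apply: bigcapT_measurable => k.
  exact: (measurable_coord k (fun h => (k <= n)%N -> h = g k)).
by apply/seteqP; split => x xg k; [move=> _; exact: xg|exact: xg].
Qed.

Lemma cylinder_admissible n g (x : X) : cylinder n g x -> admissible n g.
Proof. by move=> xg k kn; rewrite -(xg _ (ltnW kn)) -(xg _ kn) Defs.pathP. Qed.

Lemma measure_target (m : {measure set X -> \bar R}) v :
  m [set x | tgt (x 0%N) = v] =
  \esum_(g in [set g | tgt g = v]) m (cylinder 0 (fun=> g)).
Proof.
have mE (P : edge G -> Prop) : measurable [set x : X | P (x 0%N)].
  exact: measurable_coord.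
rewrite (measure_esum m (f := fun x : X => x 0%N)); last 2 first.
- exact: (mE (fun g => tgt g = v)).
- by move=> g; exact: (mE (eq^~ g)).
rewrite [RHS]esum_mkcond; apply: eq_esum => g _; case: ifPn.
  rewrite inE /= => gv.
  congr (m _); apply/seteqP; split => [x [_ /= xg] k|x xg].
    by rewrite leqn0 => /eqP ->.
  by split; rewrite /= xg.
rewrite notin_setE /= => gv; rewrite (_ : _ `&` _ = set0) ?measure0//.
by apply/seteqP; split => // x [/= xv xg]; apply: gv; rewrite -xg.
Qed.

(** Admissible cylinders together with the empty set form a generating pi-system, and those of a
    single edge are a countable cover of finite measure. *)
Lemma measure_unique_cylinder (m1 m2 : {measure set X -> \bar R}) :
  m1 setT < +oo ->
  (forall n g, admissible n g -> m1 (cylinder n g) = m2 (cylinder n g)) ->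
  forall A, measurable A -> m1 A = m2 A.
Proof.
move=> m1oo m12 A mA.
pose C : set (set X) := [set B | B = set0 \/
  exists n g, admissible n g /\ B = cylinder n g].
have mC B : C B -> measurable B.
  by move=> [->//|[n [g [_ ->]]]]; exact: measurable_cylinder.
pose F n := oapp (fun g => cylinder 0 (fun=> g)) set0 (@pickle_inv (edge G) n).
apply: (measure_unique C F) => //.
- apply/seteqP; split; last by apply: smallest_sub => //; exact: sigma_algebra_measurable.
  apply: smallest_sub; first exact: smallest_sigma_algebra.
  move=> _ [n [g ->]].
  have mD B : C B -> @measurable _ (g_sigma_algebraType C) B.
    exact: sub_sigma_algebra.
  rewrite -[smallest _ _ _]/(@measurable _ (g_sigma_algebraType C) _).
  (* Words are encoded as finite sequences with default [g], of which there are countably many;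
     indexing by functions on [nat] could give an uncountable union. *)
  rewrite (_ : mkset _ = \bigcup_(s in [set s : seq (edge G) |
      admissible n (nth g s) /\ nth g s n = g]) cylinder n (nth g s)).
    by rewrite bigcup_mkcond; apply: countable_bigcupT_measurable => // s;
      case: ifPn => [/set_mem[sa _]|_]; apply: mD; [right; exists n, (nth g s)|left].
  apply/seteqP; split=> [x /= xg|x [s [_ sg] /(_ _ (leqnn n)) xs] /=]; last by rewrite xs.
  have xs k : (k <= n)%N -> x k = nth g [seq x i | i <- iota 0 n.+1] k.
    by move=> kn; rewrite (nth_map 0%N) ?size_iota// nth_iota.
  exists [seq x i | i <- iota 0 n.+1] => //; split; last by rewrite -xs.
  exact: cylinder_admissible xs.
- move=> _ _ [->|[n [g [ag ->]]]] [->|[n' [g' [ag' ->]]]]; rewrite ?setI0 ?set0I;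
    try by left.
  wlog nn' : n n' g g' ag ag' / (n <= n')%N.
    move=> W; have [|/ltnW] := leqP n n'; first exact: W.
    by rewrite setIC; exact: W.
  have [gg'|gg'] := pselect (forall k, (k <= n)%N -> g k = g' k).
    right; exists n', g'; split=> //; apply/seteqP; split => [x []//|x xg'].
    by split=> // k kn; rewrite gg'//; apply: xg'; exact: leq_trans nn'.
  left; apply/seteqP; split => // x [xg xg']; apply: gg' => k kn.
  by rewrite -xg// xg'//; exact: leq_trans nn'.
- move=> n; rewrite /F; case: pickle_inv => [g|] /=; last by left.
  by right; exists 0%N, (fun=> g); split => // k.
- apply/seteqP; split => // x _; exists (pickle (x 0%N)) => //.
  by rewrite /F pickleK_inv /= => k; rewrite leqn0 => /eqP ->.
- by move=> B [->|[n [g [ag ->]]]]; rewrite ?measure0//; exact: m12.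
- move=> n; apply: le_lt_trans m1oo; apply: le_measure; rewrite ?inE//.
  rewrite /F; case: pickle_inv => //= g; exact: measurable_cylinder.
Qed.

End path_space_theory.

(** * Inverse branches of the shift *)

Section bernoulli_hom.
Context (R : realType) (G : stoch_graph R) (I : countType) (rho : I -> R).
Context (rho_gt0 : forall i, (0 < rho i)%R).
Context (rho_sum : \esum_(i in [set: I]) (rho i)%:E = 1).
Local Notation B := (bernoulli_graph rho_gt0 rho_sum).
Context (phi : graph_hom G B).
Local Notation X := (path_space G).
Local Notation Y := (path_space B).
Local Notation Phi := (factor_map phi).

Lemma wt_hom (g : edge G) : wt g = rho (phi g).
Proof. by have [f [_ _ _ _ <-]] := hom_edgeP phi. Qed.

Lemma hom_edge_inj (g h : edge G) : src g = src h -> phi g = phi h -> g = h.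
Proof.
move=> sgh pgh; have [f [_ _ _ /(_ (src g)) [_ inj _] _]] := hom_edgeP phi.
by apply: inj; rewrite ?inE.
Qed.

Lemma hom_edge_surj (u : vertex G) (i : I) :
  exists g : edge G, src g = u /\ phi g = i.
Proof.
have [f [_ _ _ /(_ u) [_ _ surj] _]] := hom_edgeP phi.
have [|g /= gu gi] := surj i; first by rewrite /=; case: (f u).
by exists g.
Qed.

Definition lift_edge (u : vertex G) (i : I) := projT1 (cid (hom_edge_surj u i)).

Lemma src_lift_edge u i : src (lift_edge u i) = u.
Proof. by rewrite /lift_edge; case: cid => g []. Qed.

Lemma hom_lift_edge u i : phi (lift_edge u i) = i.
Proof. by rewrite /lift_edge; case: cid => g []. Qed.

Lemma lift_edgeE g : lift_edge (src g) (phi g) = g.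
Proof. by apply: hom_edge_inj; rewrite ?src_lift_edge ?hom_lift_edge. Qed.

Definition cons_fun (i : I) (x : X) (n : nat) : edge G :=
  if n is k.+1 then x k else lift_edge (tgt (x 0%N)) i.

Lemma cons_funP i x n : src (cons_fun i x n) = tgt (cons_fun i x n.+1).
Proof. by case: n => [|n] /=; [exact: src_lift_edge|exact: Defs.pathP]. Qed.

(* The inverse branch of the shift that prepends the edge labelled i. *)
Definition cons_path (i : I) (x : X) : X := PathSpace (cons_funP i x).

Definition cons_label (i : I) (y : Y) : Y :=
  @PathSpace R B (fun n => if n is k.+1 then y k else i)
    (fun n => erefl tt).

Lemma factor_map_cons i x : Phi (cons_path i x) = cons_label i (Phi x).
Proof. by apply: path_space_eq => -[|n] //=; rewrite hom_lift_edge. Qed.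

Lemma measurable_cons_path i : measurable_fun setT (cons_path i).
Proof.
apply: measurable_fun_path => -[|n] g; rewrite setTI.
  exact: (measurable_coord 0 (fun h => lift_edge (tgt h) i = g)).
exact: (measurable_coord n (eq^~ g)).
Qed.

Lemma measurable_cons_label i : measurable_fun setT (cons_label i).
Proof.
apply: measurable_fun_path => -[|n] g; rewrite setTI.
  exact: (measurable_coord 0 (fun=> i = g)).
exact: (measurable_coord n (eq^~ g)).
Qed.

Lemma measurable_factor_map : measurable_fun setT Phi.
Proof.
apply: measurable_fun_path => n g; rewrite setTI.
exact: (measurable_coord n (fun h => phi h = g)).
Qed.

Lemma measurable_shift (H : stoch_graph R) : measurable_fun setT (@markov_shift R H).
Proof.
apply: measurable_fun_path => n g; rewrite setTI.
exact: (measurable_coord n.+1 (eq^~ g)).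
Qed.

Lemma cons_path_cylinderS n g : admissible n.+1 g ->
  cons_path (phi (g 0%N)) @^-1` cylinder n.+1 g = cylinder n (g \o succn).
Proof.
move=> ag; apply/seteqP; split => [x xg k kn|x xg [_|k] /=].
- by have /= := xg k.+1 kn.
- by rewrite xg//= -ag// lift_edgeE.
- by rewrite ltnS => kn; exact: xg.
Qed.

Lemma cons_path_cylinder0 g :
  cons_path (phi (g 0%N)) @^-1` cylinder 0 g =
  [set x : X | tgt (x 0%N) = src (g 0%N)].
Proof.
apply/seteqP; split => [x /(_ 0%N isT) /= <-|x /= xg k].
  by rewrite src_lift_edge.
by rewrite leqn0 => /eqP -> /=; rewrite xg lift_edgeE.
Qed.

Section measure.
Context (m : probability X R) (mm : markov_measure m).

Lemma markov_cylinder n g : admissible n g ->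
  m (cylinder n g) = ((\prod_(k < n.+1) wt (g k)) * stat (src (g n)))%:E.
Proof. exact: mm. Qed.

Lemma markov_target v : m [set x : X | tgt (x 0%N) = v] = (stat v)%:E.
Proof.
rewrite measure_target -stat_inv; apply: eq_esum => g _.
by rewrite [LHS]markov_cylinder// big_ord1.
Qed.

(** Both sides are finite measures in [A], so cylinders suffice. Dropping the first edge of a
    cylinder divides its measure by the weight [rho i] of that edge; a cylinder of one edge leaves
    only a condition on the endpoint, of measure [stat]. *)
Lemma markov_cons i A : measurable A ->
  m (A `&` [set x : X | phi (x 0%N) = i]) =
  (rho i)%:E * m (cons_path i @^-1` A).
Proof.
move=> mA.
have mE : measurable [set x : X | phi (x 0%N) = i].
  exact: (measurable_coord 0 (fun h => phi h = i)).
have mC := measurable_cons_path i.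
apply: (@measure_unique_cylinder R G (mrestr m mE)
  (mscale (NngNum (ltW (rho_gt0 i))) (pushforward m (cons_path i)))) => // [|n g ag].
  by rewrite /= /mrestr setTI -ge0_fin_numE// fin_num_measure.
rewrite /= /mrestr /mscale /=; rewrite /pushforward.
have [gi|gi] := pselect (phi (g 0%N) = i); last first.
  rewrite (_ : cylinder n g `&` _ = set0); last first.
    by apply/seteqP; split => // x [/(_ 0%N isT) /= xg]; rewrite /= xg.
  rewrite (_ : cons_path i @^-1` _ = set0) ?measure0 ?mule0//.
  apply/seteqP; split => // x /(_ 0%N isT) /= xg.
  by apply: gi; rewrite -xg hom_lift_edge.
rewrite (_ : cylinder n g `&` _ = cylinder n g); last first.
  by apply/setIidl => x /(_ 0%N isT) /= ->.
rewrite markov_cylinder// -gi; case: n ag => [|n] ag.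
  by rewrite cons_path_cylinder0 markov_target big_ord1 wt_hom.
rewrite cons_path_cylinderS// markov_cylinder; last by move=> k kn; exact: ag.
by rewrite big_ord_recl wt_hom -EFinM mulrA.
Qed.

(** Stationarity of m_G under prepending an edge whose label is drawn from [rho]. *)
Lemma markov_esum_cons A : measurable A ->
  m A = \esum_(i in [set: I]) ((rho i)%:E * m (cons_path i @^-1` A)).
Proof.
move=> mA; rewrite (measure_esum m (f := fun x : X => phi (x 0%N)))//.
  by apply: eq_esum => i _; rewrite -markov_cons.
by move=> i; exact: (measurable_coord 0 (fun h => phi h = i)).
Qed.

End measure.
End bernoulli_hom.

(** * Ergodicity *)

Section ergodicity.
Context (R : realType) (G : stoch_graph R) (I : countType) (rho : I -> R).
Context (rho_gt0 : forall i, (0 < rho i)%R).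
Context (rho_sum : \esum_(i in [set: I]) (rho i)%:E = 1).
Local Notation B := (bernoulli_graph rho_gt0 rho_sum).
Context (phi : graph_hom G B).
Local Notation X := (path_space G).
Local Notation Y := (path_space B).
Local Notation Phi := (factor_map phi).

(** The identity of [markov_cons] for a general measure, in order to apply it to m_G restricted to
    an invariant set. *)
Definition cons_invariant (nu : {measure set X -> \bar R}) :=
  forall i A, measurable A ->
    nu (A `&` [set x : X | phi (x 0%N) = i]) =
    (rho i)%:E * nu (cons_path phi i @^-1` A).

(** Invariance strips the edges of the word one by one, until only the condition at the source of
    the last edge remains. *)
Lemma cons_invariant_cylinder nu n g : cons_invariant nu -> admissible n g ->
  nu (cylinder n g) = (\prod_(k < n.+1) wt (g k))%:E *
                      nu [set x : X | tgt (x 0%N) = src (g n)].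
Proof.
move=> nuC; elim: n g => [|n IH] g ag.
  have -> : cylinder 0 g = cylinder 0 g `&` [set x : X | phi (x 0%N) = phi (g 0%N)].
    by apply/esym/setIidl => x /(_ 0%N isT) /= ->.
  rewrite nuC; last exact: measurable_cylinder.
  by rewrite cons_path_cylinder0 big_ord1 (wt_hom phi).
have -> : cylinder n.+1 g = cylinder n.+1 g `&` [set x : X | phi (x 0%N) = phi (g 0%N)].
  by apply/esym/setIidl => x /(_ 0%N isT) /= ->.
rewrite nuC; last exact: measurable_cylinder.
rewrite cons_path_cylinderS// IH; last by move=> k kn; exact: ag.
by rewrite muleA [in RHS]big_ord_recl (wt_hom phi) EFinM.
Qed.

(** The masses of the endpoint sets form a finite stationary vector, hence a multiple of [stat], and
    they determine the mass of every cylinder. *)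
Lemma cons_invariant_unique (m : probability X R) (nu : {measure set X -> \bar R}) :
  irreducible G -> markov_measure m -> cons_invariant nu -> nu setT < +oo ->
  exists2 c, (0 <= c)%R & forall A, measurable A -> nu A = c%:E * m A.
Proof.
move=> irrG mm nuC nufin.
pose tg v : set X := [set x : X | tgt (x 0%N) = v].
have mtg v : measurable (tg v) by exact: (measurable_coord 0 (fun g => tgt g = v)).
have nufinA A : measurable A -> nu A \is a fin_num.
  move=> mA; rewrite ge0_fin_numE//; apply: le_lt_trans nufin.
  by apply: le_measure; rewrite ?inE.
have betaE v : (fine (nu (tg v)))%:E = nu (tg v) by rewrite fineK// nufinA.
have [|||c c0 cE] := stationary_unique irrG (beta := fun v => fine (nu (tg v))).
- by move=> v; exact: fine_ge0.
- apply: le_lt_trans nufin.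
  by rewrite (measure_esum nu (f := fun x : X => tgt (x 0%N)))//;
    apply: le_esum => v _; rewrite betaE setTI.
- move=> v; rewrite betaE measure_target; apply: eq_esum => g _.
  by rewrite cons_invariant_cylinder// big_ord1 EFinM betaE.
exists c => //; pose cm : {measure set X -> \bar R} := mscale (NngNum c0) m.
apply: (measure_unique_cylinder (m2 := cm)) => // n g ag.
rewrite cons_invariant_cylinder// -betaE cE /= /mscale /= markov_cylinder//.
by rewrite !EFinM muleCA.
Qed.

(** One-sided almost invariance is enough, since mass is preserved on average over the branches. It
    makes the restriction of [m] to [E] a multiple of [m]. *)
Lemma markov_ergodic (m : probability X R) (E : set X) :
  irreducible G -> markov_measure m -> measurable E ->
  (forall i, m (E `\` cons_path phi i @^-1` E) = 0) -> m E = 0 \/ m E = 1.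
Proof.
move=> irrG mm mE subE.
have mCE i A : measurable A -> measurable (cons_path phi i @^-1` A).
  by apply: measurable_preimage; exact: measurable_cons_path.
have fin A : measurable A -> m A \is a fin_num by exact: fin_num_measure.
have rho0 i : (0 <= rho i)%R by exact: ltW.
have mEI i : m E = m (E `&` cons_path phi i @^-1` E).
  by rewrite [LHS](measureDI m mE (mCE i _ mE)) [X in X + _ = _]subE add0e.
have sumE : \esum_(i in [set: I]) ((rho i)%:E * m E) = m E.
  under eq_esum do rewrite muleC.
  rewrite -(fineK (fin _ mE)) esumZl ?rho_sum ?mule1 ?fine_ge0//.
(* Each preimage has measure at least that of [E], while their average with weights [rho] equals it,
   so equality holds for every label. *)
have mCE_eq i : m (cons_path phi i @^-1` E) = m E.
  have /(_ i) : forall i, (rho i)%:E * m E = (rho i)%:E * m (cons_path phi i @^-1` E).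
    apply: le_esum_eq.
    - by move=> j; rewrite mule_ge0// lee_fin.
    - move=> j; rewrite lee_pmul2l ?lte_fin// (mEI j).
      by apply: le_measure; rewrite ?inE//; [apply: measurableI|]; auto.
    - by rewrite sumE -markov_esum_cons.
    - by rewrite sumE -ge0_fin_numE// fin.
  move=> /(congr1 (mule ((rho i)^-1)%:E)).
  by rewrite !muleA -EFinM mulVf ?gt_eqF// !mul1e.
have supE i : m (cons_path phi i @^-1` E `\` E) = 0.
  rewrite [LHS]measureD//; last 2 first.
  - exact: mCE.
  - by rewrite -ge0_fin_numE// fin//; exact: mCE.
  transitivity (m E - m E); last by rewrite subee// fin.
  by congr (_ - _); [exact: mCE_eq|rewrite setIC; exact/esym/mEI].
(* [E] and its preimage under each branch agree up to null sets, so one may replace the other in the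
   intersection with the preimage of [A]. *)
have nuC : cons_invariant (mrestr m mE).
  move=> i A mA; rewrite /= /mrestr setIAC markov_cons//; last exact: measurableI.
  congr (_ * _); rewrite preimage_setI.
  have mA' := mCE i _ mA; have mE' := mCE i _ mE.
  rewrite (measureDI m (measurableI _ _ mA' mE') mE).
  rewrite (measureDI m (measurableI _ _ mA' mE) mE').
  rewrite [X in X + _ = _](subset_measure0 _ _ _ (supE i)); last first.
  - by move=> x [[_ ?] ?].
  - by apply: measurableD.
  - by apply: measurableD => //; apply: measurableI.
  rewrite [X in _ = X + _](subset_measure0 _ _ _ (subE i)); last first.
  - by move=> x [[_ ?] ?].
  - by apply: measurableD.
  - by apply: measurableD => //; apply: measurableI.
  by rewrite setIAC.
have [|c c0 cE] := cons_invariant_unique irrG mm nuC.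
  by rewrite /= /mrestr setTI -ge0_fin_numE// fin.
(* The restricted measure vanishes on the complement of [E]: either the factor [c] or the measure of
   the complement is 0. *)
have := cE _ (measurableC mE); rewrite /= /mrestr setICl measure0 => /esym/eqP.
rewrite mule_eq0 => /orP[|/eqP CE0].
  rewrite eqe => /eqP c00; left.
  by have := cE _ mE; rewrite /= /mrestr setIid c00 mul0e.
by right; rewrite -[E]setCK probability_setC ?CE0 ?sube0//; exact: measurableC.
Qed.

(** On cylinders, [markov_cons] splits off the first label with its factor [rho], and the inverse
    branch shifts the remaining labels. *)
Lemma factor_measure (mG : probability X R) (mI : probability Y R) A :
  markov_measure mG -> markov_measure mI -> measurable A ->
  mG (Phi @^-1` A) = mI A.
Proof.
move=> hG hI.
have mPhi := measurable_factor_map phi.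
apply: (@measure_unique_cylinder R B (pushforward mG Phi) mI) => [|n y ay].
  by rewrite /= /pushforward preimage_setT -ge0_fin_numE// fin_num_measure.
transitivity ((\prod_(k < n.+1) rho (y k))%:E); last first.
  by rewrite [RHS]markov_cylinder// mulr1.
rewrite /= /pushforward /= => {ay}; elim: n y => [|n IH] y.
  have -> : Phi @^-1` cylinder 0 y = setT `&` [set x : X | phi (x 0%N) = y 0%N].
    rewrite setTI; apply/seteqP; split => [x /(_ 0%N isT)//|x /= xy k].
    by rewrite leqn0 => /eqP ->.
  by rewrite markov_cons// preimage_setT probability_setT mule1 big_ord1.
have mcyl := measurable_preimage (measurable_factor_map phi) (measurable_cylinder n.+1 y).
have -> : Phi @^-1` cylinder n.+1 y =
    Phi @^-1` cylinder n.+1 y `&` [set x : X | phi (x 0%N) = y 0%N].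
  by apply/esym/setIidl => x /(_ 0%N isT).
rewrite markov_cons// big_ord_recl EFinM -(IH (y \o succn)).
congr (_ * mG _); apply/seteqP; split => [x xy k kn|x xy [_|k]] /=.
- exact: (xy k.+1).
- by rewrite hom_lift_edge.
- by rewrite ltnS => kn; exact: xy.
Qed.

End ergodicity.

(** * Conditional probabilities of the endpoint *)

Section density.
Context (R : realType) (G : stoch_graph R) (I : countType) (rho : I -> R).
Context (rho_gt0 : forall i, (0 < rho i)%R).
Context (rho_sum : \esum_(i in [set: I]) (rho i)%:E = 1).
Local Notation B := (bernoulli_graph rho_gt0 rho_sum).
Context (phi : graph_hom G B).
Local Notation X := (path_space G).
Local Notation Y := (path_space B).
Local Notation Phi := (factor_map phi).
Context (mG : probability X R) (mI : probability Y R).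
Hypotheses (hG : markov_measure mG) (hI : markov_measure mI).

Let tg v : set X := [set x : X | tgt (x 0%N) = v].

Let mtg v : measurable (tg v).
Proof. exact: (measurable_coord 0 (fun g => tgt g = v)). Qed.

(** [q] is a Radon-Nikodym derivative: the image under [factor_map] of m_G restricted to the paths
    ending at [v] is dominated by the measure on label sequences. *)
Lemma density_exists v : exists q : Y -> R,
  [/\ forall y, (0 <= q y)%R, measurable_fun setT q &
    forall A, measurable A ->
      mG (Phi @^-1` A `&` [set x : X | tgt (x 0%N) = v]) =
      \int[mI]_(y in A) (q y)%:E].
Proof.
pose nu1 : {measure set Y -> \bar R} := pushforward (mrestr mG (mtg v)) Phi.
have mPhi := measurable_factor_map phi.
apply: (@radon_nikodym_real _ _ _ mI (nu1 mPhi)) => [|A mA A0].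
  rewrite /= /pushforward /mrestr preimage_setT setTI.
  by rewrite -ge0_fin_numE// fin_num_measure.
rewrite /= /pushforward /mrestr.
apply: (subset_measure0 _ (measurable_preimage mPhi mA) (@subIsetl _ _ _)).
  by apply: measurableI => //; exact: measurable_preimage.
by rewrite -A0; exact: factor_measure.
Qed.

(** The shift undoes every inverse branch, so each term of [markov_esum_cons] is [rho i] times the
    measure of [A]. *)
Lemma markov_shift_invariant A : measurable A ->
  mG (@markov_shift R G @^-1` A) = mG A.
Proof.
move=> mA; rewrite (markov_esum_cons phi hG); last first.
  by apply: measurable_preimage => //; exact: measurable_shift.
have -> : mG A = \esum_(i in [set: I]) (mG A * (rho i)%:E).
  rewrite -(fineK (fin_num_measure mG _ mA)) esumZl ?rho_sum ?mule1 ?fine_ge0//.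
  by move=> i; rewrite lee_fin ltW.
apply: eq_esum => i _; rewrite muleC; congr (mG _ * _).
by apply/seteqP; split => x; rewrite /preimage /=;
  rewrite (_ : markov_shift _ = x)//; exact: path_space_eq.
Qed.

Lemma markov_label_shift_invariant A : measurable A ->
  mI (@markov_shift R B @^-1` A) = mI A.
Proof.
move=> mA; have mPhi := measurable_factor_map phi.
have mT := @measurable_shift R B.
rewrite -(factor_measure phi hG hI)//; last exact: measurable_preimage.
rewrite -[RHS](factor_measure phi hG hI)//.
rewrite -[RHS]markov_shift_invariant; last exact: measurable_preimage.
congr (mG _); apply/seteqP; split => x; rewrite /preimage /=;
  by rewrite (_ : markov_shift (Phi x) = Phi (markov_shift x))//; exact: path_space_eq.
Qed.

Lemma markov_label_cons i A : measurable A ->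
  mI (A `&` [set y : Y | y 0%N = i]) = (rho i)%:E * mI (cons_label i @^-1` A).
Proof.
move=> mA; have mPhi := measurable_factor_map phi.
have mC := @measurable_cons_label R I rho rho_gt0 rho_sum i.
have mi : measurable [set y : Y | y 0%N = i] := @measurable_coord R B 0 (eq^~ i).
rewrite -(factor_measure phi hG hI); last exact: measurableI.
rewrite -(factor_measure phi hG hI); last exact: measurable_preimage.
rewrite preimage_setI markov_cons//; last exact: measurable_preimage.
congr (_ * mG _); apply/seteqP; split => x; rewrite /preimage /=;
  by rewrite factor_map_cons.
Qed.

(** Change of variables along [cons_label i], which maps [E] onto the domain on the right and
    multiplies measures by [rho i]. *)
Lemma integral_cons_label i (f : Y -> \bar R) E : measurable E ->
  measurable_fun setT f -> (forall y, 0 <= f y) ->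
  (rho i)%:E * \int[mI]_(y in E) f (cons_label i y) =
  \int[mI]_(y in @markov_shift R B @^-1` E `&` [set y : Y | y 0%N = i]) f y.
Proof.
move=> mE mf f0; have mC := @measurable_cons_label R I rho rho_gt0 rho_sum i.
have mi : measurable [set y : Y | y 0%N = i] := @measurable_coord R B 0 (eq^~ i).
set A := _ `&` _.
have mA : measurable A.
  by apply: measurableI => //; apply: measurable_preimage => //; exact: measurable_shift.
have TC (y : Y) : markov_shift (cons_label i y) = y by exact: path_space_eq.
have CA : cons_label i @^-1` A = E.
  apply/seteqP; split => y; first by move=> [/=]; rewrite TC.
  by move=> Ey; split => //=; rewrite TC.
have mfA : measurable_fun A f by exact: measurable_funTS.
rewrite -{1}CA -[X in _ * X](ge0_integral_pushforward mC mI mA (f := f))//.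
pose push : {measure set Y -> \bar R} := pushforward mI (cons_label i).
rewrite -[in LHS](ge0_integral_mscale (push mC) mA (NngNum (ltW (rho_gt0 i))) (f := f))//.
apply: eq_measure_integral => F mF FA.
rewrite /= /mscale /= /pushforward -markov_label_cons//.
by congr (mI _); apply/setIidl => y /FA [].
Qed.

Context (q : vertex G -> Y -> R).
Hypothesis q_ge0 : forall v y, (0 <= q v y)%R.
Hypothesis mq : forall v, measurable_fun setT (q v).
Hypothesis qE : forall v A, measurable A ->
  mG (Phi @^-1` A `&` [set x : X | tgt (x 0%N) = v]) = \int[mI]_(y in A) (q v y)%:E.

Local Notation next i u := (tgt (lift_edge phi u i)).

Let mqE v (D : set Y) : measurable_fun D (fun y => (q v y)%:E).
Proof. by apply/measurable_EFinP; exact: measurable_funTS. Qed.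

Lemma density_sum : \forall y \ae mI, \esum_(v in [set: vertex G]) (q v y)%:E = 1.
Proof.
have mPhi := measurable_factor_map phi.
apply: filterS (ge0_integral_ae_eq (mu := mI) (f := cst 1)
  (g := fun y => \esum_(v in [set: vertex G]) (q v y)%:E) _ _ _ _ _) => //.
- by apply: emeasurable_esum => // v y; rewrite lee_fin.
- by rewrite integral_cst// mul1e -ge0_fin_numE// fin_num_measure.
- move=> E mE; rewrite integral_cst// mul1e integral_esum//.
  rewrite -[LHS](factor_measure phi hG hI)//.
  rewrite (measure_esum mG (f := fun x : X => tgt (x 0%N)))//; last first.
    exact: measurable_preimage.
  by apply: eq_esum => v _; rewrite -qE.
Qed.

(** Paths over [cons_label i y] ending at [v] arise from paths over [y] whose endpoint is sent to
    [v] by the label [i]. The identity is tested by integrating over measurable sets. *)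
Lemma density_cons : \forall y \ae mI, forall i v,
  (q v (cons_label i y))%:E = \esum_(u in [set u | next i u = v]) (q u y)%:E.
Proof.
apply: ae_forall_count => i; apply: ae_forall_count => v.
have mPhi := measurable_factor_map phi.
have mC := @measurable_cons_label R I rho rho_gt0 rho_sum i.
have mi : measurable [set y : Y | y 0%N = i] := @measurable_coord R B 0 (eq^~ i).
have mTB := @measurable_shift R B.
pose f u y := if u \in [set u | next i u = v] then (q u y)%:E else 0.
have f0 u y : 0 <= f u y by rewrite /f; case: ifP => // _; rewrite lee_fin.
have mf u D : measurable_fun D (f u) by rewrite /f; case: (u \in _).
have intE E : measurable E -> \int[mI]_(y in E) (\esum_(u in [set: vertex G]) f u y) =
    mG (Phi @^-1` E `&` [set x : X | next i (tgt (x 0%N)) = v]).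
  move=> mE; rewrite integral_esum//.
  have mN : measurable [set x : X | next i (tgt (x 0%N)) = v].
    exact: (measurable_coord 0 (fun g => next i (tgt g) = v)).
  rewrite (measure_esum mG (f := fun x : X => tgt (x 0%N)))//; last first.
    by apply: measurableI => //; exact: measurable_preimage.
  apply: eq_esum => u _; rewrite /f; case: (boolP (u \in _)) => [|].
    rewrite inE /= => nu; rewrite -qE//; congr (mG _).
    apply/seteqP; split => x [] /=; first by move=> ? xu; rewrite xu.
    by move=> [? _].
  rewrite notin_setE /= => nu; rewrite integral0 (_ : _ `&` _ = set0) ?measure0//.
  by apply/seteqP; split => // x [[_ /= xv] xu]; apply: nu; rewrite -xu.
have : \forall y \ae mI, \esum_(u in [set: vertex G]) f u y = (q v (cons_label i y))%:E.
  apply: ge0_integral_ae_eq.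
  - exact: emeasurable_esum.
  - by apply/measurable_EFinP; exact: measurableT_comp.
  - by move=> y; exact: esum_ge0.
  - rewrite intE// -ge0_fin_numE// fin_num_measure//.
    apply: measurableI; first exact: measurable_preimage.
    exact: (measurable_coord 0 (fun g => next i (tgt g) = v)).
  - move=> E mE; rewrite intE//.
    (* The factor [rho i] turns both sides into masses of paths whose first label is [i]. *)
    suff : (rho i)%:E * mG (Phi @^-1` E `&` [set x : X | next i (tgt (x 0%N)) = v]) =
        (rho i)%:E * \int[mI]_(y in E) (q v (cons_label i y))%:E.
      move=> /(congr1 (mule ((rho i)^-1)%:E)).
      by rewrite !muleA -EFinM mulVf ?gt_eqF// !mul1e.
    rewrite (integral_cons_label i mE (f := fun y => (q v y)%:E))//; last first.
      by move=> y; rewrite lee_fin.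
    rewrite -qE; last by apply: measurableI => //; exact: measurable_preimage mTB mE.
    rewrite preimage_setI setIAC markov_cons//; last first.
      apply: measurableI; last exact: mtg.
      exact: measurable_preimage mPhi (measurable_preimage mTB mE).
    congr (_ * mG _).
    have TC (x : X) : markov_shift (Phi (cons_path phi i x)) = Phi x.
      by apply: path_space_eq.
    by apply/seteqP; split => x [xE xv]; split; rewrite /preimage /= ?TC in xE *.
by apply: filterS => y <-; rewrite [RHS]esum_mkcond.
Qed.

Lemma measurable_density_target (P : set R) : measurable P ->
  measurable [set x : X | P (q (tgt (x 0%N)) (Phi x))].
Proof.
move=> mP; have mPhi := measurable_factor_map phi.
rewrite (_ : mkset _ = \bigcup_v (tg v `&` Phi @^-1` (q v @^-1` P))).
  apply: measurable_bigcup_count => v; apply: measurableI => //.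
  by apply: measurable_preimage => //; exact: measurable_preimage.
apply/seteqP; split => [x Px|x [v _ [/= -> //]]].
by exists (tgt (x 0%N)).
Qed.

(* The conditional probability of one's own endpoint can only increase under
   prepending an edge, so its superlevel sets are invariant. *)
Lemma density_target_cst : irreducible G ->
  exists c, \forall x \ae mG, q (tgt ((x : X) 0%N)) (Phi x) = c.
Proof.
move=> irrG; have mPhi := measurable_factor_map phi.
apply: ae_bool_cst => r.
pose E := [set x : X | (r < q (tgt (x 0%N)) (Phi x))%R].
have mE : measurable E.
  have := @measurable_density_target `]r, +oo[ (measurable_itv _).
  by congr measurable; apply/seteqP; split => x /=; rewrite in_itv /= andbT.
have [|E0|E1] := markov_ergodic irrG hG mE (phi := phi).
- move=> i; apply: measure_negligible.
    apply: measurableD => //; apply: measurable_preimage => //.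
    exact: measurable_cons_path.
  have : \forall x \ae mG, forall i v, (q v (cons_label i (Phi x)))%:E =
      \esum_(u in [set u | next i u = v]) (q u (Phi x))%:E.
    apply: (ae_preimage mPhi _ density_cons) => A mA; exact: factor_measure.
  apply: negligibleS => x [Ex nEx] /= H; apply: nEx; rewrite /E /preimage /=.
  apply: (lt_le_trans Ex); rewrite -lee_fin factor_map_cons H.
  rewrite (esumID [set tgt (x 0%N)])//; last by move=> u _; rewrite lee_fin.
  rewrite (_ : _ `&` [set _] = [set tgt (x 0%N)]); last by apply/setIidr => _ ->.
  by rewrite esum_set1 ?lee_fin// leeDl// esum_ge0// => u _; rewrite lee_fin.
- right; exists E; split => // x /= /negP; by rewrite -ltNge.
- left; exists (~` E); split => //; first exact: measurableC.
  by rewrite probability_setC// E1 subee.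
Qed.

(** The integral of [q v] over [q v != c] is the mass of the paths that end at [v] and see a value
    other than [c], which is 0; as [q v] is nonnegative, it vanishes almost everywhere there. *)
Lemma density_values c : (\forall x \ae mG, q (tgt ((x : X) 0%N)) (Phi x) = c) ->
  \forall y \ae mI, forall v, q v y = 0%R \/ q v y = c.
Proof.
move=> aec; apply: ae_forall_count => v.
have mPhi := measurable_factor_map phi.
pose A := [set y | q v y != c].
have mA : measurable A.
  have : measurable (q v @^-1` (~` [set c])).
    by apply: measurable_preimage => //; apply: measurableC; exact: measurable_set1.
  by congr measurable; apply/seteqP; split => y /eqP.
have : \int[mI]_(y in A) `|(q v y)%:E| = 0.
  under eq_integral do rewrite gee0_abs ?lee_fin//.
  rewrite -qE//; apply: measure_negligible.
    by apply: measurableI; [exact: measurable_preimage mPhi mA|exact: mtg].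
  by apply: negligibleS aec => x [/= Ax xv] /= xc; move: Ax; rewrite /A /= -xv xc eqxx.
move=> /(ae_eq_integral_abs mI mA (@mqE v A)).
apply: filterS => y Ay; have [->|qc] := eqVneq (q v y) c; first by right.
by left; have [] := Ay qc.
Qed.

End density.

(** * Lifts of a label sequence *)

Section lifts.
Context (R : realType) (G : stoch_graph R) (I : countType) (rho : I -> R).
Context (rho_gt0 : forall i, (0 < rho i)%R).
Context (rho_sum : \esum_(i in [set: I]) (rho i)%:E = 1).
Local Notation B := (bernoulli_graph rho_gt0 rho_sum).
Context (phi : graph_hom G B).
Local Notation X := (path_space G).
Local Notation Y := (path_space B).
Local Notation Phi := (factor_map phi).
Context (q : vertex G -> Y -> R) (c : R).
Hypothesis q_ge0 : forall v y, (0 <= q v y)%R.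
Hypothesis c_gt0 : (0 < c)%R.

Local Notation next i u := (tgt (lift_edge phi u i)).
Local Notation T := (@markov_shift R B).

(** The almost sure properties of the conditional probabilities, gathered so that the lifting
    arguments become pointwise. *)
Definition regular_label (y : Y) :=
  [/\ forall v, q v y = 0%R \/ q v y = c,
      \esum_(v in [set: vertex G]) (q v y)%:E = 1 &
      forall i v, (q v (cons_label i y))%:E =
        \esum_(u in [set u | next i u = v]) (q u y)%:E].

(** Only paths through charged vertices count; the fibre of [y] may contain others, which will be
    discarded as a null set. *)
Definition lifts (y : Y) (x : X) :=
  Phi x = y /\ forall k, q (tgt (x k)) (iter k T y) = c.

Lemma iter_shift (H : stoch_graph R) (x : path_space H) k n :
  iter k (@markov_shift R H) x n = x (k + n)%N.
Proof. by elim: k n => // k IH n; rewrite iterS /= IH addnS. Qed.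

Section regular.
Context (y : Y) (yreg : forall k, regular_label (iter k T y)).

(** The vertices charged by the k-th shift of [y]; the map attached to [y k] will carry [A k.+1]
    bijectively onto [A k]. *)
Let A k := [set v | q v (iter k T y) = c].

Lemma density_step k v : (q v (iter k T y))%:E =
  \esum_(u in [set u | next (y k) u = v]) (q u (iter k.+1 T y))%:E.
Proof.
have [_ _ <-] := yreg k.+1; congr (q v _)%:E.
by apply: path_space_eq => -[|n] /=; rewrite !iter_shift ?addn0// addSnnS.
Qed.

(** The image vertex receives at least the mass [c > 0], so its own mass is not 0. *)
Lemma atom_next k u : A k.+1 u -> A k (next (y k) u).
Proof.
rewrite /A /= => uc; have [+ _ _] := yreg k => /(_ (next (y k) u)) [|//] q0.
have := density_step k (next (y k) u); rewrite q0 (esumID [set u]); last first.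
  by move=> v _; rewrite lee_fin.
rewrite (_ : _ `&` [set u] = [set u]); last by apply/setIidr => _ ->.
rewrite esum_set1 ?lee_fin// => /esym/eqP; rewrite padde_eq0 ?lee_fin//.
  by rewrite uc eqe gt_eqF.
by apply: esum_ge0 => v _; rewrite lee_fin.
Qed.

(** Two charged vertices with the same image would give it mass at least [2c], whereas it has mass
    [c]. *)
Lemma atom_inj k u v : A k.+1 u -> A k.+1 v -> next (y k) u = next (y k) v -> u = v.
Proof.
rewrite /A /= => uc vc uv; apply: contrapT => neq.
have := density_step k (next (y k) u).
have -> : q (next (y k) u) (iter k T y) = c by exact: atom_next.
rewrite (esumID [set u; v]); last by move=> w _; rewrite lee_fin.
rewrite (_ : _ `&` [set u; v] = [set u; v]); last first.
  by apply/setIidr => _ [->|->].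
rewrite esum_fset//; last by move=> w _; rewrite lee_fin.
rewrite fsbigU//=; last by move=> w [/= -> /neq].
rewrite !fsbig_set1 uc vc => /eqP.
rewrite eq_sym -addeA gt_eqF// lteDl// lte_paddr ?lte_fin//.
by apply: esum_ge0 => w _; rewrite lee_fin.
Qed.

(** If no charged vertex were sent to [v], the masses arriving there would all vanish. *)
Lemma atom_surj k v : A k v -> exists2 u, A k.+1 u & next (y k) u = v.
Proof.
move=> vc; apply: contrapT => H; have := density_step k v.
rewrite vc esum1 => [[] c0|u /= uv]; first by move: c_gt0; rewrite c0 ltxx.
have [+ _ _] := yreg k.+1 => /(_ u) [->//|uc].
by exfalso; apply: H; exists u.
Qed.

Lemma lifts_exists v : A 0 v -> exists2 x, lifts y x & tgt (x 0%N) = v.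
Proof.
move=> v0.
(* [pre k] chooses a charged preimage under the map of [y k], with a default value off [A k];
   iterating it gives the endpoints [w k] of the edges of the lift. *)
pose pre k (v : vertex G) : vertex G :=
  if pselect (A k v) is left h then
    projT1 (cid (let: ex_intro2 u h1 h2 := atom_surj h in ex_intro _ u (conj h1 h2)))
  else v.
have preP k w : A k w -> A k.+1 (pre k w) /\ next (y k) (pre k w) = w.
  by move=> kw; rewrite /pre; case: pselect => // h; case: cid.
pose w := fix w k := if k is k'.+1 then pre k' (w k') else v.
have wA k : A k (w k) by elim: k => //= k /preP[].
(* Edge [k] leaves [w k.+1] with label [y k] and therefore ends at [w k]. *)
have xP k : src (lift_edge phi (w k.+1) (y k)) = tgt (lift_edge phi (w k.+2) (y k.+1)).
  by rewrite src_lift_edge; have [_ ->] := preP _ _ (wA k.+1).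
exists (PathSpace xP); last by have [_ ->] := preP _ _ (wA 0%N).
split; first by apply: path_space_eq => k /=; rewrite hom_lift_edge.
by move=> k /=; have [_ ->] := preP _ _ (wA k); exact: wA.
Qed.

Lemma lifts_src x k : lifts y x -> A k.+1 (src (x k)).
Proof. by move=> [_ xA]; rewrite Defs.pathP; exact: xA. Qed.

Lemma lifts_next x k : lifts y x -> next (y k) (src (x k)) = tgt (x k).
Proof. by move=> [<- _]; rewrite /= lift_edgeE. Qed.

(** By injectivity on charged vertices equal targets force equal sources, which are the targets of
    the next edges; the equality thus spreads to all coordinates. *)
Lemma lifts_unique x x' : lifts y x -> lifts y x' ->
  tgt (x 0%N) = tgt (x' 0%N) -> x = x'.
Proof.
move=> xl x'l xx'.
have srcE k : tgt (x k) = tgt (x' k) -> src (x k) = src (x' k).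
  by rewrite -(lifts_next k xl) -(lifts_next k x'l); apply: atom_inj; exact: lifts_src.
have {}xx' k : tgt (x k) = tgt (x' k).
  by elim: k => // k /srcE; rewrite !Defs.pathP.
apply: path_space_eq => k; apply: (@hom_edge_inj _ _ _ _ _ _ phi).
  exact: srcE.
by have [/(congr1 (fun z : Y => z k)) /= -> _] := xl; have [<- _] := x'l.
Qed.

End regular.
End lifts.

(** * The kernel of conditional measures carried by the lifts *)

Section kernel.
Context (R : realType) (G : stoch_graph R) (I : countType) (rho : I -> R).
Context (rho_gt0 : forall i, (0 < rho i)%R).
Context (rho_sum : \esum_(i in [set: I]) (rho i)%:E = 1).
Local Notation B := (bernoulli_graph rho_gt0 rho_sum).
Context (phi : graph_hom G B).
Local Notation X := (path_space G).
Local Notation Y := (path_space B).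
Local Notation Phi := (factor_map phi).
Context (mG : probability X R).
Context (q : vertex G -> Y -> R) (c : R) (Y0 : set Y).
Hypothesis q_ge0 : forall v y, (0 <= q v y)%R.
Hypothesis mq : forall v, measurable_fun setT (q v).
Hypothesis c_gt0 : (0 < c)%R.
Hypothesis mY0 : measurable Y0.
Local Notation next i u := (tgt (lift_edge phi u i)).
Local Notation T := (@markov_shift R B).
Hypothesis Y0_regular : forall y, Y0 y -> forall k, regular_label phi q c (iter k T y).

Definition atoms (v : vertex G) : set Y := Y0 `&` [set y | q v y = c].

Definition lift_from (v : vertex G) (y : Y) : X :=
  if pselect (exists2 x, lifts phi q c y x & tgt (x 0%N) = v) is left h
  then s2val (cid2 h) else point.

Lemma lift_fromP v y : atoms v y ->
  lifts phi q c y (lift_from v y) /\ tgt (lift_from v y 0%N) = v.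
Proof.
move=> [/Y0_regular yreg vc]; rewrite /lift_from; case: pselect => [h|[]].
  by case: cid2.
exact: (lifts_exists c_gt0 yreg vc).
Qed.

Lemma lift_fromE y x : Y0 y -> lifts phi q c y x -> lift_from (tgt (x 0%N)) y = x.
Proof.
move=> y0 xl; have [xl' xx'] : lifts phi q c y (lift_from (tgt (x 0%N)) y) /\
    tgt (lift_from (tgt (x 0%N)) y 0%N) = tgt (x 0%N).
  by apply: lift_fromP; split => //; have [_ /(_ 0%N)] := xl.
exact: (lifts_unique q_ge0 c_gt0 (Y0_regular y0)).
Qed.

(** Composition of the maps attached to the labels [k - 1] down to 0 of [y]: it recovers the first
    endpoint of a lift from the target of its edge [k]. *)
Fixpoint descend (y : Y) (k : nat) (u : vertex G) : vertex G :=
  if k is k'.+1 then descend y k' (next (y k') u) else u.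

Lemma lifts_descend y x k : lifts phi q c y x ->
  descend y k (tgt (x k)) = tgt (x 0%N).
Proof.
by move=> xl; elim: k => //= k <-; rewrite -Defs.pathP (lifts_next _ xl).
Qed.

Lemma descend_inj y k u v : Y0 y ->
  q u (iter k T y) = c -> q v (iter k T y) = c ->
  descend y k u = descend y k v -> u = v.
Proof.
move=> /Y0_regular yreg; elim: k u v => // k IH u v uc vc /IH uv.
apply: (atom_inj q_ge0 c_gt0 yreg uc vc).
by apply: uv; exact: (atom_next q_ge0 c_gt0 yreg).
Qed.

Lemma measurable_descend k u v : measurable [set y | descend y k u = v].
Proof.
elim: k u => [|k IH] u /=.
  have [->|uv] := pselect (u = v).
    by rewrite (_ : mkset _ = setT)//; apply/seteqP; split.
  by rewrite (_ : mkset _ = set0)//; apply/seteqP; split.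
rewrite (_ : mkset _ = \bigcup_(i : I) ([set y : Y | y k = i] `&`
    [set y | descend y k (next i u) = v])).
  apply: measurable_bigcup_count => i; apply: measurableI; last exact: IH.
  exact: (@measurable_coord R B k (eq^~ i)).
by apply/seteqP; split => [y yv|y [i _ [/= <-]]] //; exists (y k).
Qed.

Lemma measurable_iter_shift k : measurable_fun setT (iter k T).
Proof.
elim: k => [|k IH]; first exact: measurable_id.
by apply: measurableT_comp IH; exact: measurable_shift.
Qed.

Lemma measurable_atom v k : measurable [set y | q v (iter k T y) = c].
Proof.
exact: measurable_preimage (measurable_iter_shift k)
  (measurable_preimage (mq v) (measurable_set1 c)).
Qed.

(** This describes the coordinates by measurable conditions on [y], free of the choice made in
    [lift_from]. The edge is unique because [descend] is injective on charged vertices. *)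
Lemma lift_from_coord v y k g : atoms v y ->
  lift_from v y k = g <-> [/\ phi g = y k,
    q (src g) (iter k.+1 T y) = c & descend y k.+1 (src g) = v].
Proof.
move=> vy; have [xl xv] := lift_fromP vy; move: (lift_from v y) xl xv => x xl xv.
have [y0 _] := vy; have labE n : phi (x n) = y n by have [<- _] := xl.
split => [<-|[gy gc gv]].
  split; [exact: labE|exact: (lifts_src _ xl)|].
  by rewrite -xv -(lifts_descend k.+1 xl) Defs.pathP.
apply: (@hom_edge_inj _ _ _ _ _ _ phi); last by rewrite labE.
apply: (@descend_inj y k.+1 _ _ y0 _ gc); first exact: (lifts_src _ xl).
by rewrite gv -xv -(lifts_descend k.+1 xl) Defs.pathP.
Qed.

Lemma measurable_atoms v : measurable (atoms v).
Proof. by apply: measurableI => //; exact: (measurable_atom v 0). Qed.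

Lemma measurable_lift_from v : measurable_fun (atoms v) (lift_from v).
Proof.
apply: measurable_fun_path => k g.
rewrite (_ : _ `&` _ = atoms v `&` ([set y : Y | y k = phi g] `&`
    ([set y | q (src g) (iter k.+1 T y) = c] `&`
     [set y | descend y k.+1 (src g) = v]))).
  apply: measurableI; first exact: measurable_atoms.
  apply: measurableI; first exact: (@measurable_coord R B k (eq^~ (phi g))).
  by apply: measurableI; [exact: measurable_atom|exact: measurable_descend].
apply/seteqP; split => y [vy].
  by move=> /(lift_from_coord _ _ vy) [-> gc gv].
by move=> [/= gy [gc gv]]; split => //; apply/lift_from_coord.
Qed.

(** A unit mass, not yet weighted by [c]: the normalization in [lift_kernel] supplies that
    factor. *)
Definition branch (v : vertex G) (y : Y) : {measure set X -> \bar R} :=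
  if pselect (atoms v y) then (dirac (lift_from v y) : {measure set X -> \bar R})
  else mzero.

Lemma branchE v y U : branch v y U = (\1_(atoms v `&` lift_from v @^-1` U) y)%:E.
Proof.
rewrite /branch indicE in_setI; case: pselect => vy.
  by rewrite mem_set// /= diracE.
by rewrite memNset.
Qed.

Let measurable_branch v U : measurable U -> measurable_fun setT (branch v ^~ U).
Proof.
move=> mU; under eq_fun do rewrite branchE.
apply/measurable_EFinP; apply: measurable_indic.
by apply: measurable_lift_from => //; exact: measurable_atoms.
Qed.

HB.instance Definition _ v :=
  isKernel.Build _ _ _ _ R (branch v) (measurable_branch v).

Let branches (n : nat) : R.-ker Y ~> X :=
  if @pickle_inv (vertex G) n is Some v then branch v else @kzero _ _ Y X R.

(* Normalizing supplies mG as a junk value off Y0. *)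
Definition lift_kernel : R.-pker Y ~> X := knormalize (kseries branches) mG.

(** The [q v y] sum to 1 and each is 0 or [c], so the unnormalized mass is [c^-1] and normalizing
    gives each branch the weight [c = q v y]. *)
Lemma lift_kernelE y U : Y0 y ->
  lift_kernel y U = \esum_(v in [set: vertex G])
    ((q v y)%:E * (\1_U (lift_from v y))%:E).
Proof.
move=> y0; have [q0c qsum _] := Y0_regular y0 0%N.
have qE v : (q v y)%:E = c%:E * branch v y setT.
  rewrite branchE preimage_setT setIT indicE; have [vy|vy] := pselect (atoms v y).
    by rewrite mem_set// mule1; case: vy => _ ->.
  rewrite memNset// mule0; have [->//|vc] := q0c v.
  by exfalso; apply: vy.
pose ks := kseries branches.
have ksE V : ks y V = \esum_(v in [set: vertex G]) branch v y V.
  rewrite esum_pickle// /ks /= /mseries; apply: eq_eseriesr => n _.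
  by rewrite /branches; case: pickle_inv.
have ksT : ks y setT = (c^-1)%:E.
  have : c%:E * ks y setT = 1.
    rewrite ksE -esumZl ?ltW// -[RHS]qsum; apply: eq_esum => v _.
    by rewrite qE.
  move=> /(congr1 (mule (c^-1)%:E)).
  by rewrite muleA -EFinM mulVf ?gt_eqF// mul1e mule1.
rewrite /lift_kernel /= /knormalize /mnormalize -/ks ksT /=.
rewrite eqe invr_eq0 gt_eqF//= invrK ksE muleC -esumZl ?ltW//.
apply: eq_esum => v _; rewrite qE !branchE preimage_setT setIT !indicE in_setI.
rewrite -!EFinM -mulrA -natrM mulnb; congr (c * (_ && _)%:R)%:E.
Qed.

End kernel.

(** * Disintegration of the Markov measure over label sequences *)

Section fibres.
Context (R : realType) (G : stoch_graph R) (I : countType) (rho : I -> R).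
Context (rho_gt0 : forall i, (0 < rho i)%R).
Context (rho_sum : \esum_(i in [set: I]) (rho i)%:E = 1).
Local Notation B := (bernoulli_graph rho_gt0 rho_sum).
Context (phi : graph_hom G B).
Local Notation X := (path_space G).
Local Notation Y := (path_space B).
Local Notation Phi := (factor_map phi).
Context (mG : probability X R) (mI : probability Y R).
Hypotheses (hG : markov_measure mG) (hI : markov_measure mI).
Hypothesis irrG : irreducible G.

Lemma uniform_fibre_measures : exists (n : nat) (kappa : R.-pker Y ~> X) (N : set X),
  [/\ fibre_measures mG mI Phi kappa, mG.-negligible N,
      forall x x', ~ N x -> ~ N x' -> Phi x = Phi x' ->
        tgt (x 0%N) = tgt (x' 0%N) -> x = x' &
      \forall y \ae mI, (Phi @^-1` [set y] `\` N #= `I_n.+1)%card /\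
        forall x, (Phi @^-1` [set y] `\` N) x ->
          kappa y [set x] = (n.+1%:R^-1)%:E].
Proof.
have mPhi := measurable_factor_map phi.
have [q /all_and3[q_ge0 mq qE]] := choice (density_exists phi hG hI).
have [c aec] := density_target_cst hG hI q_ge0 mq qE irrG.
pose T := @markov_shift R B.
(* Shift invariance of the label measure gives regularity along the whole orbit, as lifting
   requires. *)
have : \forall y \ae mI, forall k, regular_label phi q c (iter k T y).
  apply: ae_iter => [|A mA|].
  - exact: measurable_shift.
  - exact: (markov_label_shift_invariant phi hG hI).
  have h1 := density_values q_ge0 mq qE aec.
  have h2 := density_sum hG hI q_ge0 mq qE.
  have h3 := density_cons hG hI q_ge0 mq qE.
  by apply: filterS3 h1 h2 h3 => y *; split.
move=> [Z [mZ Z0 YZ]]; pose Y0 := ~` Z.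
have mY0 : measurable Y0 by exact: measurableC.
have Y0_ae : \forall y \ae mI, Y0 y by exists Z; split => // y /contrapT.
have Y0_reg y : Y0 y -> forall k, regular_label phi q c (iter k T y).
  by move=> nZy; apply: contrapT => /YZ.
have [y0 Y0y0] : exists y, Y0 y.
  apply: contrapT => H; have : mI.-negligible setT.
    by apply: negligibleS Y0_ae => y _ /= Yy; apply: H; exists y.
  move=> /(measure_negligible measurableT) /eqP.
  by rewrite [X in X == _]probability_setT onee_eq0.
(* The value [c] does not depend on [y], so one regular sequence fixes [n] for all of them. *)
have [n [cn _]] : exists n, c = n.+1%:R^-1%R /\
    ([set v | q v y0 = c] #= `I_n.+1)%card.
  have [qc qs _] := Y0_reg _ Y0y0 0%N.
  exact: (esum_two_values (q_ge0^~ y0) qc qs).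
have c_gt0 : (0 < c)%R by rewrite cn invr_gt0 ltr0n.
have cardA y : Y0 y -> ([set v | q v y = c] #= `I_n.+1)%card.
  move=> Yy; have [qc qs _] := Y0_reg _ Yy 0%N.
  have [m [cm Am]] := esum_two_values (q_ge0^~ y) qc qs.
  suff -> : n = m by [].
  by move: cn; rewrite cm => /invr_inj /eqP; rewrite eqr_nat => /eqP -[].
have uniq y := lifts_unique q_ge0 c_gt0 (y := y).
pose good x := Y0 (Phi x) /\ lifts phi q c (Phi x) x.
have good_ae : \forall x \ae mG, good x.
  have h1 : \forall x \ae mG, Y0 (Phi x).
    by apply: (ae_preimage mPhi _ Y0_ae) => A mA; exact: factor_measure.
  have h2 : \forall x \ae mG, forall k,
      q (tgt (iter k (@markov_shift R G) x 0%N)) (Phi (iter k (@markov_shift R G) x)) = c.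
    apply: (ae_iter _ _ aec) => [|A mA]; first exact: measurable_shift.
    exact: (markov_shift_invariant phi hG).
  apply: filterS2 h1 h2 => x Yx qx; split => //; split => // k.
  rewrite -(qx k) iter_shift addn0; congr (q _ _).
  by apply: path_space_eq => m; rewrite iter_shift /= iter_shift.
(* The exceptional set: the paths that are not lifts of a regular label sequence. *)
pose N := ~` [set x | good x].
exists n, (lift_kernel mG q_ge0 mq c_gt0 mY0 Y0_reg), N.
have lE := lift_kernelE mG q_ge0 mq c_gt0 mY0 Y0_reg.
have atomsP y v : Y0 y -> q v y <> 0%R -> atoms q c Y0 v y.
  by move=> Yy qv; have [/(_ v)[]] := Y0_reg _ Yy 0%N.
have liftP := lift_fromP c_gt0 Y0_reg.
split.
- split.
    apply: filterS Y0_ae => y Yy.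
    have mF : measurable (Phi @^-1` [set y]).
      by apply: measurable_preimage => //; exact: measurable_path_set1.
    exists (~` (Phi @^-1` [set y])); split; first exact: measurableC.
      rewrite lE// esum1// => v _.
      have [->|qv] := pselect (q v y = 0%R); first by rewrite mul0e.
      have [[Px _] _] := liftP _ _ (atomsP _ _ Yy qv).
      by rewrite indicE memNset ?mule0//= => /(_ Px).
    by move=> x /=.
  move=> A mA.
  pose S v := atoms q c Y0 v `&` lift_from phi q c v @^-1` A.
  have mS v : measurable (S v).
    apply: (measurable_lift_from q_ge0 mq c_gt0 mY0 Y0_reg) => //.
    exact: measurable_atoms.
  rewrite (measure_esum mG (f := fun x : X => tgt (x 0%N)))//; last first.
    by move=> v; exact: (measurable_coord 0 (fun g => tgt g = v)).
  transitivity (\int[mI]_y \esum_(v in [set: vertex G])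
      (((fun y => (q v y)%:E) \_ (S v)) y)).
    rewrite integral_esum//; last 2 first.
    + move=> v; apply/(measurable_restrictT _ (mS v)).
      by apply/measurable_EFinP; exact: measurable_funTS.
    + by move=> v y; apply: erestrict_ge0 => z _; rewrite lee_fin.
    apply: eq_esum => v _; rewrite -integral_mkcond -qE//.
    have mv : measurable [set x : X | tgt (x 0%N) = v].
      exact: (measurable_coord 0 (fun g => tgt g = v)).
    (* A good path ending at [v] is the lift from [v] of its labels, so it lies in [A] exactly when
       its labels lie in [S v]. *)
    apply: measure_ae_eq.
    + exact: measurableI.
    + by apply: measurableI => //; exact: measurable_preimage.
    apply: filterS good_ae => x [Yx xl]; split => -[/= Ax xv]; split => //=.
      rewrite /S /preimage /= -xv (lift_fromE q_ge0 c_gt0 Y0_reg)//.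
      by split => //; split => //; have [_ /(_ 0%N)] := xl.
    by case: Ax => _; rewrite /preimage /= -xv (lift_fromE q_ge0 c_gt0 Y0_reg).
  apply: ge0_ae_eq_integral => //.
  + apply: emeasurable_esum => v.
      apply/(measurable_restrictT _ (mS v)).
      by apply/measurable_EFinP; exact: measurable_funTS.
    by move=> y; apply: erestrict_ge0 => z _; rewrite lee_fin.
  + exact: measurable_kernel.
  + move=> y _; apply: esum_ge0 => v _; apply: erestrict_ge0 => z _.
    by rewrite lee_fin.
  apply: filterS Y0_ae => y Yy _; rewrite lE//; apply: eq_esum => v _.
  rewrite patchE; have [qv|qv] := pselect (q v y = 0%R).
    by rewrite qv mul0e; case: ifP.
  rewrite /S in_setI mem_set; last exact: atomsP.
  rewrite indicE (_ : _ \in A = (y \in lift_from phi q c v @^-1` A)).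
    by case: (y \in _); rewrite ?mule1 ?mule0.
  by apply/idP/idP; rewrite !inE.
- exact: good_ae.
- move=> x x' /contrapT [Yx xl] /contrapT [_ xl'] PP.
  by rewrite -PP in xl'; exact: uniq (Y0_reg _ Yx) _ _ xl xl'.
apply: filterS Y0_ae => y Yy.
have FE : Phi @^-1` [set y] `\` N = (lift_from phi q c)^~ y @` [set v | q v y = c].
  apply/seteqP; split => [x [/= <- /contrapT [Yx xl]]|_ [v /= vc <-]].
    exists (tgt (x 0%N)); first by have [_ /(_ 0%N)] := xl.
    exact: (lift_fromE q_ge0 c_gt0 Y0_reg).
  have [vl _] := liftP v y (conj Yy vc); have [Pv _] := vl.
  by split => // Nv; apply: Nv => /=; split; rewrite Pv.
split.
  rewrite FE; apply: card_eq_trans (cardA _ Yy); apply: inj_card_eq.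
  move=> u v; rewrite !inE /= => uc vc uv.
  have [_ <-] := liftP u y (conj Yy uc); have [_ <-] := liftP v y (conj Yy vc).
  by rewrite uv.
move=> x; rewrite FE => -[v /= vc <-]; rewrite lE// -cn.
have [_ tv] := liftP v y (conj Yy vc).
(* Lifts from different charged vertices have different endpoints, so only the term of [v]
   remains. *)
rewrite (esumID [set v])//; last by move=> u _; rewrite mule_ge0 ?lee_fin.
rewrite setTI esum_set1; last by rewrite mule_ge0 ?lee_fin.
rewrite indicE mem_set// mule1 vc esum1 ?adde0// => u [_ /= uv].
have [->|qu] := pselect (q u y = 0%R); first by rewrite mul0e.
have [_ tu] := liftP _ _ (atomsP _ _ Yy qu).
rewrite indicE memNset ?mule0//= => luv; apply: uv.
by rewrite -tu -tv luv.
Qed.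

End fibres.

(** * Indices *)

(** Indices are positive integers or infinite, and a finite one occurs, so the well-ordering of
    [nat] provides the minimum. *)
Lemma minimal_index_exists d (X : measurableType d) (R : realType)
    (m : probability X R) (T : X -> X) (I : countType) (rho : I -> R)
    (beta : X -> I) (n : nat) :
  Delta m T rho beta -> is_index m T beta n.+1%:R%:E ->
  exists k, is_minimal_index m T rho k.
Proof.
move=> Db ib.
pose P k := `[< exists2 b : X -> I, Delta m T rho b & is_index m T b k.+1%:R%:E >].
have exP : exists k, P k by exists n; apply/asboolP; exists beta.
have [k /asboolP Pk kmin] := ex_minnP exP.
exists k.+1%:R%:E; split => // b l Dl il.
have [[[j lj]|->] _] := il; last by rewrite leey.
rewrite lj lee_fin ler_nat ltnS; apply: kmin; apply/asboolP; exists b => //.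
by rewrite -lj.
Qed.

Section bernoulli_factor.
Context (R : realType) (G : stoch_graph R) (I : countType) (rho : I -> R).
Context (rho_gt0 : forall i, (0 < rho i)%R).
Context (rho_sum : \esum_(i in [set: I]) (rho i)%:E = 1).
Local Notation B := (bernoulli_graph rho_gt0 rho_sum).
Context (phi : graph_hom G B).
Local Notation X := (path_space G).
Local Notation Y := (path_space B).
Local Notation Phi := (factor_map phi).

(** Measures and independence come from [markov_cons]. The join with the preimage of points
    separates paths because the first edge is determined by its label and its source, the latter
    being the target of the next edge. *)
Lemma hom_label_Delta (mG : probability X R) : markov_measure mG ->
  Delta mG (@markov_shift R G) rho (hom_label phi).
Proof.
move=> hG.
have mi i : measurable [set x : X | phi (x 0%N) = i].
  exact: (measurable_coord 0 (fun h => phi h = i)).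
have rhoE i : mG (hom_label phi @^-1` [set i]) = (rho i)%:E.
  rewrite -[X in mG X]setTI markov_cons// preimage_setT.
  by rewrite probability_setT mule1.
split => //.
- move=> i A mA; rewrite rhoE setIC markov_cons//; last first.
    by rewrite -[X in measurable X]setTI; exact: measurable_shift.
  rewrite (markov_shift_invariant phi)//; congr (_ * mG _).
  by apply/seteqP; split => x; rewrite /preimage /=;
    rewrite (_ : markov_shift _ = x)//; exact: path_space_eq.
- exists set0; split; first exact: negligible_set0.
  move=> x y _ _; split => [[xy Txy]|-> //].
  have Exy n : x n.+1 = y n.+1 := congr1 (fun z : X => z n) Txy.
  apply: path_space_eq => -[|//]; apply: (@hom_edge_inj _ _ _ _ _ _ phi) xy.
  by rewrite !Defs.pathP Exy.
Qed.

Lemma delta_infty_hom_label (x y : X) :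
  delta_infty (@markov_shift R G) (hom_label phi) x y <-> Phi x = Phi y.
Proof.
split => [xy|xy n].
  apply: path_space_eq => n; have := xy n.
  by rewrite /part_preimage /level_part /hom_label !iter_shift addn0.
rewrite /part_preimage /level_part /hom_label !iter_shift addn0.
exact: (congr1 (fun z : Y => z n) xy).
Qed.

End bernoulli_factor.

Theorem theorem3p18 (R : realType) (G : stoch_graph R)
    (I : countType) (rho : I -> R)
    (rho_gt0 : forall i, (0 < rho i)%R)
    (rho_sum : \esum_(i in [set: I]) (rho i)%:E = 1)
    (phi : graph_hom G (bernoulli_graph rho_gt0 rho_sum))
    (mG : probability (path_space G) R)
    (mI : probability (path_space (bernoulli_graph rho_gt0 rho_sum)) R) :
  irreducible G -> markov_measure mG -> markov_measure mI ->
  part_eq_mod0 mG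
    (part_join (@zeta R G) (delta_infty (@markov_shift R G) (hom_label phi)))
    (@epsilon (path_space G)) /\
  exists dT dT_delta d_phi : \bar R,
    [/\ is_minimal_index mG (@markov_shift R G) rho dT,
        is_index mG (@markov_shift R G) (hom_label phi) dT_delta,
        is_degree mG mI phi d_phi &
        [/\ dT <= dT_delta, dT_delta = d_phi & d_phi < +oo]].
Proof.
move=> irrG hG hI.
have [n [kappa [N [[kfib kE] N0 uniq kpt]]]] := uniform_fibre_measures phi hG hI irrG.
have mPhi := measurable_factor_map phi.
have kinv : (n.+1%:R%:E : \bar R)^-1 = (n.+1%:R^-1)%:E.
  by rewrite inver pnatr_eq0.
have Phi_ae P : (\forall y \ae mI, P y) -> \forall x \ae mG, P (factor_map phi x).
  by apply: ae_preimage mPhi _ => A mA; exact: factor_measure.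
have index : is_index mG (@markov_shift R G) (hom_label phi) n.+1%:R%:E.
  split; first by left; exists n.
  (* Elements of the partition generated by the labels are fibres of the factor map, so the
     conditional measure at [x] is the fibre measure over the image of [x]. *)
  exists (kernel_comp kappa mPhi); split; first split.
  - by move=> x y /delta_infty_hom_label xy A; rewrite /= /kernel_comp xy.
  - apply: filterS (Phi_ae _ kfib) => x; apply: filterS => z xz.
    exact/delta_infty_hom_label.
  - move=> A mA; rewrite kE//.
    rewrite -(@ge0_integral_pushforward _ _ _ _ _ _ mPhi mG setT (kappa ^~ A))//.
      by apply: eq_measure_integral => E mE _; apply/esym; exact: factor_measure.
    exact: measurable_kernel.
  - have Nae : \forall x \ae mG, ~ N x by apply: negligibleS N0 => x /= /contrapT.
    apply: filterS2 Nae (Phi_ae _ kpt) => x Nx [_ /(_ x)].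
    by rewrite kinv; apply.
split.
  (* Off [N] a path is determined by its labels and its first endpoint, and the first edge gives
     that endpoint. *)
  exists N; split => // x x' Nx Nx'; split => [[x0 /delta_infty_hom_label xx']|-> //].
  by apply: uniq => //; rewrite x0.
have [dT dT_min] := minimal_index_exists (hom_label_Delta phi hG) index.
exists dT, n.+1%:R%:E, n.+1%:R%:E; split => //.
- exists kappa, N; split => //; apply: filterS kpt => y [cardF kF].
  split; last by move=> x /kF; rewrite kinv.
  have finF : finite_set (factor_map phi @^-1` [set y] `\` N).
    by apply/finite_setP; exists n.+1.
  by rewrite /counting asboolT// (card_fset_set cardF).
- split; [|by []|exact: ltry].
  by have [_] := dT_min; apply; [exact: hom_label_Delta|exact: index].
Qed.
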